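(* Suppose that $|U|<(1+\alpha)|V|$ and that for every $a\in V$ there exists an isoperimetric numbering of length at least $\tilde s$ starting with $a$. Then $$\lim_{\lambda\to\infty}\mathbb{P}_u\left(\frac{\hat T_v}{\mathbb{E}_u[\hat T_v]}>t\right)=e^{-t}\qquad\text{uniformly in }t\in\mathbb{R}^+.$$
   Context: Hard-core dynamics. Let $G=(U,V,E)$ be a finite, simple, undirected, connected bipartite graph with non-empty parts $U,V$ (every edge has one endpoint in $U$ and one in $V$). Vertices are called sites. A configuration is an independent set $x\subseteq U\cup V$ (''there is a particle at $k$'' means $k\in x$); $\mathcal{X}$ is the set of configurations. The configuration $u$ is the one with particles exactly at all sites of $U$, and $v$ the one with particles exactly at all sites of $V$. Fix $0<\alpha<1$. Sites in $U$ have activity $\lambda_k=\lambda$ and sites in $V$ have activity $\lambda_k=\bar\lambda=\varphi(\lambda)$, where $\varphi(\lambda)=\lambda^{1+\alpha+o(1)}$ as $\lambda\to\infty$. The continuous-time Markov chain $(\hat X(t))_{t\ge 0}$ on $\mathcal{X}$ evolves as follows, all sites acting independently: at an empty site $k$ none of whose neighbours is occupied, a particle appears at rate $\lambda_k$; each particle disappears at rate $1$. $\mathbb{P}_u,\mathbb{E}_u$ refer to the chain started from $u$, and $\hat T_v=\inf\{t\ge0:\hat X(t)=v\}$. Isoperimetry. For $A\subseteq V$, $N(A)\subseteq U$ is the set of neighbours of elements of $A$, $\Delta(A)=|N(A)|-|A|$, and $\Delta(s)=\min\{\Delta(A):A\subseteq V,|A|=s\}$. A set $A\subseteq V$ is isoperimetrically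 optimal if $\Delta(A)=\Delta(|A|)$. An isoperimetric numbering of length $n$ is a sequence $a_1,\dots,a_n$ of distinct elements of $V$ such that $\{a_1,\dots,a_i\}$ is isoperimetrically optimal for each $1\le i\le n$. The critical size $s^*$ is the smallest positive integer (in $\{1,\dots,|V|\}$) maximising $g(s)=\Delta(s)-\alpha(s-1)$. The resettling size $\tilde s$ is the smallest integer larger than $s^*$ such that $\Delta(\tilde s)\le\alpha\tilde s$. *)

(* Defs.v *)
From HB Require Import structures.
From mathcomp Require Import all_boot all_order all_algebra.
From mathcomp Require Import all_classical all_reals all_analysis.

Set Implicit Arguments.
Unset Strict Implicit.
Unset Printing Implicit Defensive.

Import Order.TTheory GRing.Theory Num.Theory.
Import numFieldNormedType.Exports.

Local Open Scope ring_scope.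

(* A bipartite graph G = (U, V, E) is given by the finite types U and V of its
   two parts and the incidence E : U -> V -> bool; its sites form U + V. *)

Section Graph.
Variables (U V : finType) (E : U -> V -> bool).

Definition adjacent (j k : U + V) : bool :=
  match j, k with
  | inl a, inr b => E a b
  | inr b, inl a => E a b
  | _, _ => false
  end.

Definition connected_graph : Prop := forall j k : U + V, connect adjacent j k.

Definition independent (x : {set U + V}) : bool :=
  [forall j in x, forall k in x, ~~ adjacent j k].

Definition config := {x : {set U + V} | independent x}.

Lemma independent_allU : independent [set k : U + V | is_inl k]%SET.
Proof.
by apply/forall_inP => -[a|b]; rewrite inE // => _;
  apply/forall_inP => -[a'|b']; rewrite inE.
Qed.

Lemma independent_allV : independent [set k : U + V | ~~ is_inl k]%SET.
Proof.
by apply/forall_inP => -[a|b]; rewrite inE // => _;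
  apply/forall_inP => -[a'|b']; rewrite inE.
Qed.

Definition config_u : config := Sub _ independent_allU.
Definition config_v : config := Sub _ independent_allV.

Definition neighbours (A : {set V}) : {set U} :=
  [set a | [exists b in A, E a b]]%SET.

Definition deficit (A : {set V}) : int := #|neighbours A|%:Z - #|A|%:Z.

(* For s <= #|V| the minimum ranges over a nonempty family, and the default
   value #|U| bounds every deficit A from above, so it plays no role. *)
Definition min_deficit (s : nat) : int :=
  \big[Num.min/#|U|%:Z]_(A : {set V} | #|A| == s) deficit A.

Definition isoperimetrically_optimal (A : {set V}) : Prop :=
  deficit A = min_deficit #|A|.

Definition isoperimetric_numbering (s : seq V) : Prop :=
  uniq s /\
  forall i, (1 <= i <= size s)%N ->
    isoperimetrically_optimal [set b in take i s]%SET.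

Section Sizes.
Variables (R : realType) (alpha : R).

Definition gain (s : nat) : R := (min_deficit s)%:~R - alpha * (s%:R - 1).

Definition maximises_gain (s : nat) : Prop :=
  (1 <= s <= #|V|)%N /\
  forall r, (1 <= r <= #|V|)%N -> gain r <= gain s.

Definition critical_size (s : nat) : Prop :=
  maximises_gain s /\ forall r, maximises_gain r -> (s <= r)%N.

(* min_deficit is only meaningful up to #|V|. *)
Definition resettling_candidate (sstar s : nat) : Prop :=
  (sstar < s <= #|V|)%N /\ (min_deficit s)%:~R <= alpha * s%:R.

Definition resettling_size (sstar s : nat) : Prop :=
  resettling_candidate sstar s /\
  forall r, resettling_candidate sstar r -> (s <= r)%N.

End Sizes.

Section Rates.
Variables (R : realType) (lambda lambdabar : R).

Definition activity (k : U + V) : R := if is_inl k then lambda else lambdabar.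

Definition free_site (x : {set U + V}) (k : U + V) : bool :=
  (k \notin x) && [forall j in x, ~~ adjacent j k].

(* Total rate of the jumps from x to y, for x != y; at most one site k
   contributes. *)
Definition jump_rate (x y : config) : R :=
  \sum_(k : U + V)
    (if free_site (val x) k && (val y == k |: val x)%SET then activity k
     else if (k \in val x) && (val y == val x :\ k)%SET then 1
     else 0).

Definition hardcore_generator (x y : config) : R :=
  if x == y then - \sum_(z : config | z != x) jump_rate x z
  else jump_rate x y.

End Rates.
End Graph.

Local Open Scope classical_set_scope.

Section MarkovChain.
Variables (R : realType) (S : finType).

(* Transition probabilities p t x y of the continuous-time chain on S with
   infinitesimal generator Q. *)
Definition transition_function (Q : S -> S -> R) (p : R -> S -> S -> R) : Prop :=
  [/\ forall t x y, 0 <= t -> 0 <= p t x y,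
      forall t x, 0 <= t -> \sum_y p t x y = 1,
      forall x y, p 0 x y = (x == y)%:R,
      forall s t x y, 0 <= s -> 0 <= t ->
        p (s + t) x y = \sum_z p s x z * p t z y &
      forall x y, (p h x y - (x == y)%:R) / h @[h --> 0^'+] --> Q x y].

Variables (d : measure_display) (Omega : measurableType d)
  (P : probability Omega R).

(* Only the variables X t with t >= 0 are constrained. *)
Definition markov_process (p : R -> S -> S -> R) (x0 : S)
    (X : R -> Omega -> S) : Prop :=
  [/\ forall t x, 0 <= t -> measurable [set w | X t w = x],
      forall w t, 0 <= t -> \forall s \near t^'+, X s w = X t w,
      P [set w | X 0 w = x0] = 1%E &
      forall (n : nat) (ts : nat -> R) (xs : nat -> S),
        0 <= ts 0%N -> (forall i, ts i <= ts i.+1) ->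
        P [set w | forall i, (i <= n.+1)%N -> X (ts i) w = xs i] =
        (P [set w | forall i, (i <= n)%N -> X (ts i) w = xs i] *
         (p (ts n.+1 - ts n) (xs n) (xs n.+1))%:E)%E].

Definition markov_chain (Q : S -> S -> R) (x0 : S) (X : R -> Omega -> S) : Prop :=
  exists2 p, transition_function Q p & markov_process p x0 X.

(* +oo when y is never visited. *)
Definition hitting_time (X : R -> Omega -> S) (y : S) (w : Omega) : \bar R :=
  ereal_inf [set t%:E | t in [set t : R | 0 <= t /\ X t w = y]].

Definition mean_hitting_time (X : R -> Omega -> S) (y : S) : \bar R :=
  (\int[P]_w hitting_time X y w)%E.

Definition normalised_survival (X : R -> Omega -> S) (y : S) (t : R) : R :=
  fine (P [set w | (t%:E < hitting_time X y w / mean_hitting_time X y)%E]).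

End MarkovChain.

(* phi lambda = lambda ^ (1 + alpha + o(1)) as lambda -> +oo. *)
Definition activity_exponent (R : realType) (alpha : R) (phi : R -> R) : Prop :=
  exists2 eps : R -> R, eps x @[x --> +oo] --> (0 : R) &
    \forall lambda \near +oo, phi lambda = lambda `^ (1 + alpha + eps lambda).

(* Main.v *)
Require Import Defs.
From mathcomp Require Import all_boot all_order all_algebra.
From mathcomp Require Import all_classical all_reals all_analysis.
From mathcomp Require Import measurable_realfun.
From mathcomp Require Import ring lra.

(** Let G be the Green kernel of the chain killed at v. By reversibility
    everything is governed by one number: the excursion ratio, i.e. the mean time
    spent away from u before hitting v, divided by the mean time G(u,u) spent at
    u. If it is at most eps, then the equilibrium potential h of u is almost an
    eigenfunction of the killed semigroup for the eigenvalue kappa = 1/G(u,u),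
    whence exp(-kappa t) <= P_u(T > t) <= exp(-kappa t) + 2 eps and
    1 <= kappa E_u[T] <= 1 + eps. The semigroup is only ever handled through its
    Euler steps 1 + hQ.

    That the ratio tends to 0 is potential theory. Let s0 be the first size with
    Delta(s0) <= alpha s0, and Gamma the maximum of the gain g on [1, s0],
    attained at s1. Every path from u to v crosses the cut "s1 sites of V
    occupied, or s1 - 1 of them and room for one more", whose conductance is
    lambda^-Gamma times the weight of u; hence G(u,u) is at least of order
    lambda^Gamma. Conversely, if some but not all sites of V are occupied, adding
    the sites of an isoperimetric numbering that starts next to the occupied ones
    costs strictly less than Gamma, because N is submodular and Delta(i) > alpha i
    for i < s0; so such a y has G(y,y) of order lambda^(Gamma - delta), which
    bounds G(u,y). A configuration y <> u without particles on V has a weight at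
    least lambda times smaller than that of u. *)

Set Implicit Arguments.
Unset Strict Implicit.
Unset Printing Implicit Defensive.

Import Order.TTheory GRing.Theory Num.Theory.
Import numFieldNormedType.Exports.

Local Open Scope ring_scope.

(** * Electrical networks killed at a vertex *)

Section Network.
Variables (R : realType) (S : finType) (c : S -> S -> R).
Hypothesis c_sym : forall x y, c x y = c y x.
Hypothesis c_ge0 : forall x y, 0 <= c x y.

Definition laplacian (f : S -> R) (x : S) : R := \sum_z c x z * (f x - f z).

Definition energy (f g : S -> R) : R := \sum_x g x * laplacian f x.

Lemma energyE f g :
  energy f g = 2^-1 * \sum_x \sum_z c x z * ((f x - f z) * (g x - g z)).
Proof.
have E1 : energy f g = \sum_x \sum_z c x z * ((f x - f z) * g x).
  by apply: eq_bigr => x _; rewrite mulr_sumr; apply: eq_bigr => z _; ring.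
have E2 : energy f g = \sum_x \sum_z c x z * ((f z - f x) * g z).
  rewrite E1 exchange_big/=; apply: eq_bigr => z _; apply: eq_bigr => x _.
  by rewrite c_sym.
have -> : \sum_x \sum_z c x z * ((f x - f z) * (g x - g z)) =
    energy f g + energy f g.
  rewrite {1}E1 E2 -big_split/=; apply: eq_bigr => x _.
  by rewrite -big_split/=; apply: eq_bigr => z _; ring.
by field.
Qed.

Lemma energyC f g : energy f g = energy g f.
Proof.
rewrite !energyE; congr (_ * _); apply: eq_bigr => x _; apply: eq_bigr => z _.
by rewrite [X in _ * X]mulrC.
Qed.

Lemma energy_ge0 f : 0 <= energy f f.
Proof.
rewrite energyE mulr_ge0 ?invr_ge0//; do 2 apply: sumr_ge0 => ? _.
by rewrite mulr_ge0// -expr2 sqr_ge0.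
Qed.

Lemma le_energy f g f' g' :
  (forall x z, (f x - f z) * (g x - g z) <= (f' x - f' z) * (g' x - g' z)) ->
  energy f g <= energy f' g'.
Proof.
move=> H; rewrite !energyE ler_wpM2l ?invr_ge0//.
by apply: ler_sum => x _; apply: ler_sum => z _; rewrite ler_wpM2l.
Qed.

(* The discriminant of the quadratic form energy (f - t g) (f - t g). *)
Lemma energy_cauchy_schwarz f g :
  energy f g ^+ 2 <= energy f f * energy g g.
Proof.
have P (t : R) :
    0 <= energy f f - 2 * t * energy f g + t ^+ 2 * energy g g.
  have -> : energy f f - 2 * t * energy f g + t ^+ 2 * energy g g =
      energy (fun x => f x - t * g x) (fun x => f x - t * g x).
    rewrite !energyE; set A := \sum_x _; set B := \sum_x _; set D := \sum_x _.
    have -> : \sum_x \sum_z c x z * ((f x - t * g x - (f z - t * g z)) *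
        (f x - t * g x - (f z - t * g z))) = A - 2 * t * B + t ^+ 2 * D.
      rewrite /A /B /D !mulr_sumr -sumrB -big_split/=; apply: eq_bigr => x _.
      rewrite !mulr_sumr -sumrB -big_split/=; apply: eq_bigr => z _; ring.
    ring.
  exact: energy_ge0.
have [g0|gn0] := eqVneq (energy g g) 0.
  have [->|fgn0] := eqVneq (energy f g) 0; first by rewrite g0 mulr0 expr0n.
  have := P ((energy f f + 1) / (2 * energy f g)).
  rewrite g0 mulr0 addr0.
  have -> : 2 * ((energy f f + 1) / (2 * energy f g)) * energy f g =
    energy f f + 1 by field.
  by have := energy_ge0 f; lra.
have gp : 0 < energy g g by rewrite lt_def gn0 energy_ge0.
have := P (energy f g / energy g g).
have -> : energy f f - 2 * (energy f g / energy g g) * energy f g +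
    (energy f g / energy g g) ^+ 2 * energy g g =
    (energy f f * energy g g - energy f g ^+ 2) / energy g g by field.
by rewrite pmulr_lge0 ?invr_gt0// subr_ge0.
Qed.

Lemma edge_energy f x z : c x z * (f x - f z) ^+ 2 <= energy f f.
Proof.
have [->|xz] := eqVneq x z.
  by rewrite subrr expr0n mulr0 energy_ge0.
pose t a b := c a b * ((f a - f b) * (f a - f b)).
have t0 a b : 0 <= t a b by rewrite mulr_ge0// -expr2 sqr_ge0.
have le1 a b : t a b <= \sum_y t a y.
  by rewrite (bigD1 b)//= lerDl sumr_ge0.
have : t x z + t z x <= \sum_a \sum_b t a b.
  rewrite (bigD1 x)//= [X in _ <= _ + X](bigD1 z)/=; last by rewrite eq_sym.
  rewrite addrA -[leLHS]addr0; apply: lerD; first exact: lerD.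
  by rewrite sumr_ge0// => a _; rewrite sumr_ge0.
rewrite energyE => H.
have txz : t z x = t x z by rewrite /t c_sym; ring.
have -> : c x z * (f x - f z) ^+ 2 = 2^-1 * (t x z + t z x).
  by rewrite txz /t; field.
by rewrite ler_wpM2l ?invr_ge0.
Qed.

Lemma path_drop (f : S -> R) (e : rel S) (w : R) :
  (forall x z, e x z -> `|f x - f z| <= w) ->
  forall p x, path e x p -> `|f x - f (last x p)| <= (size p)%:R * w.
Proof.
move=> H; elim=> [|y p IH] x /=; first by rewrite subrr normr0 mul0r.
move=> /andP[exy pp]; rewrite -(subrKA (f y)) -natr1 mulrDl mul1r addrC.
by rewrite (le_trans (ler_normD _ _))// lerD// ?H// IH.
Qed.

(** A crude series law: a simple path has fewer than [#|S|] edges, and on an edge of conductance at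
    least [m] the drop is at most the square root of [energy f f / m]. *)
Lemma connect_resistance (m : R) y v f : 0 < m ->
  connect [rel x z | m <= c x z] y v ->
  (f y - f v) ^+ 2 <= #|S|%:R ^+ 2 / m * energy f f.
Proof.
move=> m0 /connectP[p0 /shortenP[p pp up _] ->].
pose w := Num.sqrt (energy f f / m).
have Em : 0 <= energy f f / m by rewrite divr_ge0 ?energy_ge0 ?ltW.
have step x z : [rel x z | m <= c x z] x z -> `|f x - f z| <= w.
  move=> /= mc; rewrite -(@ler_pXn2r _ 2) ?nnegrE ?sqrtr_ge0//.
  rewrite real_normK ?num_real// sqr_sqrtr// ler_pdivlMr// mulrC.
  apply: le_trans (edge_energy f x z).
  by rewrite ler_wpM2r ?sqr_ge0.
have := path_drop step pp.
have sp : (size p)%:R * w <= #|S|%:R * w.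
  rewrite ler_wpM2r ?sqrtr_ge0// ler_nat.
  by have /card_uniqP/= := up => e; rewrite -ltnS -e ltnW// ltnS max_card.
move=> /le_trans/(_ sp) H.
have := H; rewrite -(@ler_pXn2r _ 2) ?nnegrE ?mulr_ge0 ?sqrtr_ge0//.
by rewrite real_normK ?num_real// exprMn sqr_sqrtr// mulrA mulrAC.
Qed.

(** * Green kernels grounded at [v] *)

Section Green.
Variables (v : S) (res : S -> R).
(* [res y] bounds the effective resistance between [y] and [v]. *)
Hypothesis resP : forall f y, f v = 0 -> f y ^+ 2 <= res y * energy f f.

Lemma energy_eq0 f : f v = 0 -> energy f f = 0 -> forall x, f x = 0.
Proof.
move=> fv E0 x; apply/eqP; rewrite -sqrf_eq0 eq_le sqr_ge0 andbT.
by have := resP x fv; rewrite E0 mulr0.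
Qed.

(** The voltage when a unit current enters at [y] and [v] is grounded. *)
Definition is_green (y : S) (g : S -> R) : Prop :=
  g v = 0 /\ forall x, x != v -> laplacian g x = (x == y)%:R.

(** The Laplacian matrix with row [v] replaced by the identity row is invertible: a function in its
    kernel vanishes at [v] and has zero energy. *)
Lemma green_exists y : y != v -> exists g, is_green y g.
Proof.
move=> yv; pose n := #|S|; pose i2s (i : 'I_n) : S := enum_val i.
pose B : 'M[R]_n := \matrix_(i, j)
  (if i2s i == v then (i == j)%:R
   else if i == j then \sum_z c (i2s i) z - c (i2s i) (i2s i)
   else - c (i2s i) (i2s j)).
have i2sK x : i2s (enum_rank x) = x by rewrite /i2s enum_rankK.
have BE (w : 'cV[R]_n) i : (B *m w) i 0 =
    if i2s i == v then w i 0
    else laplacian (fun x => w (enum_rank x) 0) (i2s i).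
  rewrite mxE; case: ifPn => iv.
    rewrite (bigD1 i)//= mxE iv eqxx mul1r big1 ?addr0// => j ji.
    by rewrite mxE iv eq_sym (negPf ji) mul0r.
  have -> : laplacian (fun x => w (enum_rank x) 0) (i2s i) =
     (\sum_z c (i2s i) z) * w i 0 - \sum_j c (i2s i) (i2s j) * w j 0.
    rewrite /laplacian; under eq_bigr do rewrite mulrBr.
    rewrite sumrB mulr_suml /i2s enum_valK; congr (_ - _).
    rewrite (reindex_onto (fun j : 'I_n => enum_val j) enum_rank)/=; last first.
      by move=> x _; rewrite enum_rankK.
    under eq_bigl do rewrite enum_valK eqxx.
    by apply: eq_bigr => j _; rewrite enum_valK.
  rewrite (bigD1 i)//= [X in _ - X](bigD1 i)//= mxE (negPf iv) eqxx.
  rewrite mulrBl opprD addrA; congr (_ + _); rewrite -sumrN.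
  by apply: eq_bigr => j ji; rewrite mxE (negPf iv) eq_sym (negPf ji) mulNr.
have ker (w : 'cV[R]_n) : B *m w = 0 -> w = 0.
  move=> Bw; pose f x := w (enum_rank x) 0.
  have fv : f v = 0.
    by have := BE w (enum_rank v); rewrite i2sK eqxx Bw mxE.
  have E0 : energy f f = 0.
    apply: big1 => x _; have [->|xv] := eqVneq x v; first by rewrite fv mul0r.
    have := BE w (enum_rank x); rewrite i2sK (negPf xv) Bw mxE => <-.
    by rewrite mulr0.
  apply/matrixP => i j; rewrite (ord1 j) mxE -[RHS](energy_eq0 fv E0 (i2s i)).
  by rewrite /f /i2s enum_valK.
have uB : B^T \in unitmx.
  rewrite -row_free_unit -kermx_eq0; apply/eqP/row_matrixP => i.
  rewrite row0 -[LHS]trmxK; set w := (row i (kermx B^T))^T.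
  rewrite (ker w) ?trmx0//.
  by apply: trmx_inj; rewrite trmx_mul trmxK -row_mul mulmx_ker row0 trmx0.
rewrite unitmx_tr in uB.
pose e : 'cV[R]_n := \col_i (i == enum_rank y)%:R.
have Bw : B *m (invmx B *m e) = e by rewrite mulKVmx.
exists (fun x => (invmx B *m e) (enum_rank x) 0); split=> [|x xv].
  have := BE (invmx B *m e) (enum_rank v); rewrite i2sK eqxx Bw mxE => <-.
  by rewrite (inj_eq enum_rank_inj) eq_sym (negPf yv).
have := BE (invmx B *m e) (enum_rank x); rewrite i2sK (negPf xv) Bw mxE => <-.
by rewrite (inj_eq enum_rank_inj).
Qed.

(** The reproducing property in the Dirichlet space of functions vanishing at [v]. *)
Lemma green_energy y g f : is_green y g -> f v = 0 -> energy g f = f y.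
Proof.
move=> [gv gL] fv; rewrite /energy (bigD1 y)//= big1 => [|x xy].
  rewrite addr0; have [->|yv] := eqVneq y v; first by rewrite fv mul0r.
  by rewrite gL// eqxx mulr1.
have [->|xv] := eqVneq x v; first by rewrite fv mul0r.
by rewrite gL// (negPf xy) mulr0.
Qed.

Lemma green_sym x y gx gy : is_green x gx -> is_green y gy -> gx y = gy x.
Proof.
move=> Gx Gy; rewrite -(green_energy Gy Gx.1) energyC.
by rewrite (green_energy Gx Gy.1).
Qed.

(** Truncation: the energy of [f], the minimum of [g] and 0, is at most [energy g f], which is
    [f y <= 0] by the reproducing property. *)
Lemma green_ge0 y g : is_green y g -> forall x, 0 <= g x.
Proof.
move=> G x; pose f x := Num.min (g x) 0.
have fv : f v = 0 by rewrite /f G.1 minxx.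
suff fx : f x = 0 by rewrite -fx /f ge_min lexx.
apply: (energy_eq0 fv); apply/eqP; rewrite eq_le energy_ge0 andbT.
have fy : f y <= 0 by rewrite /f ge_min lexx orbT.
rewrite (le_trans _ fy)// -(green_energy G fv); apply: le_energy => a b.
rewrite /f; case: (leP (g a) 0); case: (leP (g b) 0); nra.
Qed.

(** The maximum principle, by truncating at the level [g y]; the excess vanishes at [y], hence has
    energy zero. *)
Lemma green_le_diag y g : is_green y g -> forall x, g x <= g y.
Proof.
move=> G x; pose f x := Num.max (g x - g y) 0.
have gy := green_ge0 G y.
have fv : f v = 0 by rewrite /f G.1 sub0r; apply/max_idPr; rewrite oppr_le0.
have fy : f y = 0 by rewrite /f subrr maxxx.
suff fx : f x = 0 by rewrite -subr_le0 -fx /f le_max lexx.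
apply: (energy_eq0 fv); apply/eqP; rewrite eq_le energy_ge0 andbT.
rewrite -fy -(green_energy G fv); apply: le_energy => a b.
rewrite /f; case: (leP (g a - g y) 0); case: (leP (g b - g y) 0); nra.
Qed.

Lemma green_diag_gt0 y g : y != v -> is_green y g -> 0 < g y.
Proof.
move=> yv G; rewrite lt_def (green_ge0 G) andbT; apply/eqP => gy0.
have E0 : energy g g = 0 by rewrite (green_energy G G.1).
have := G.2 y yv; rewrite eqxx /laplacian big1 => [/esym/eqP|z _].
  by rewrite oner_eq0.
by rewrite !(energy_eq0 G.1 E0) subrr mulr0.
Qed.

Lemma green_diag_le y g : y != v -> is_green y g -> g y <= res y.
Proof.
move=> yv G; have := resP y G.1; rewrite (green_energy G G.1) expr2.
by rewrite ler_pM2r ?(green_diag_gt0 yv G).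
Qed.

(** The Dirichlet principle: a test potential bounds the effective conductance [1 / g y] from
    above. *)
Lemma green_diag_ge y g f : is_green y g -> f v = 0 -> f y = 1 ->
  1 <= g y * energy f f.
Proof.
move=> G fv fy; have := energy_cauchy_schwarz g f.
by rewrite (green_energy G fv) (green_energy G G.1) fy expr1n.
Qed.

End Green.
End Network.

(** * The Euler scheme of the killed chain *)

Section KilledWalk.
Variables (R : realType) (S : finType) (Q : S -> S -> R) (u v : S) (h : R).

(* [killed n] is row [u] of the [n]-th power of the Euler step [1 + h Q] of the
   chain killed at [v]. *)
Fixpoint killed (n : nat) (y : S) : R :=
  if n is n'.+1 then
    if y == v then 0 else \sum_z killed n' z * ((z == y)%:R + h * Q z y)
  else (y == u)%:R.

Variables (c : S -> S -> R) (pi : S -> R) (k : S -> S -> R) (res : S -> R).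
Hypotheses (c_sym : forall x y, c x y = c y x) (c_ge0 : forall x y, 0 <= c x y).
Hypothesis resP :
  forall f y, f v = 0 -> f y ^+ 2 <= res y * energy c f f.
Hypotheses (pi_gt0 : forall x, 0 < pi x)
  (Q_off : forall x y, x != y -> pi x * Q x y = c x y)
  (Q_row : forall x, \sum_y Q x y = 0).
Hypotheses (uv : u != v) (kP : forall y, y != v -> is_green c v y (k y)).

(** With [pi] reversible, [pi y * k u y] is the mean time that the chain from [u] spends at [y]
    before hitting [v]. *)
Definition escape_rate : R := (pi u * k u u)^-1.
Definition excursion_ratio : R :=
  \sum_(y | y != u) pi y * k u y / (pi u * k u u).

Local Notation kappa := escape_rate.
Local Notation eps := excursion_ratio.

Let kuu_gt0 : 0 < k u u. Proof. exact: (green_diag_gt0 c_sym c_ge0 resP uv (kP uv)). Qed.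
Let ku_ge0 y : 0 <= k u y. Proof. exact: (green_ge0 c_sym c_ge0 resP (kP uv)). Qed.

Lemma escape_rate_gt0 : 0 < kappa.
Proof. by rewrite invr_gt0 mulr_gt0. Qed.

Lemma excursion_ratio_ge0 : 0 <= eps.
Proof.
by apply: sumr_ge0 => y _; rewrite divr_ge0 ?mulr_ge0 ?ku_ge0// ltW.
Qed.

Lemma generator_laplacian f x : \sum_y Q x y * f y = - (laplacian c f x / pi x).
Proof.
have -> : \sum_y Q x y * f y = \sum_y Q x y * (f y - f x).
  under [RHS]eq_bigr do rewrite mulrBr.
  by rewrite sumrB -mulr_suml Q_row mul0r subr0.
rewrite mulr_suml -sumrN; apply: eq_bigr => y _.
have [->|xy] := eqVneq x y; first by rewrite subrr !mulr0 mul0r oppr0.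
by rewrite -Q_off//; field; rewrite gt_eqF.
Qed.

(** The Euler step is moved onto the test function; as [f v = 0], the mass killed at [v] is not seen
    by [f]. *)
Lemma killed_dual n f : f v = 0 ->
  \sum_y killed n.+1 y * f y =
  \sum_z killed n z * (f z - h * (laplacian c f z / pi z)).
Proof.
move=> fv.
transitivity (\sum_y \sum_z killed n z * (((z == y)%:R + h * Q z y) * f y)).
  apply: eq_bigr => y _ /=; case: eqVneq => [->|yv].
    by rewrite fv mul0r big1// => z _; rewrite !mulr0.
  by rewrite mulr_suml; apply: eq_bigr => z _; rewrite mulrA.
rewrite exchange_big/=; apply: eq_bigr => z _; rewrite -mulr_sumr.
congr (_ * _); rewrite -[h * (_ / _)]opprK -mulrN -generator_laplacian opprK.
under eq_bigr do rewrite mulrDl -mulrA.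
rewrite big_split/= -mulr_sumr; congr (_ + _).
rewrite (bigD1 z)//= eqxx mul1r big1 ?addr0// => y yz.
by rewrite eq_sym (negPf yz) mul0r.
Qed.

Lemma killed_v n : killed n v = 0.
Proof. by case: n => [|n]/=; rewrite ?eqxx// eq_sym (negPf uv). Qed.

Lemma laplacian_scale f (a : R) x :
  laplacian c (fun y => f y * a) x = laplacian c f x * a.
Proof. by rewrite mulr_suml; apply: eq_bigr => z _; ring. Qed.

Lemma laplacian_sum (P : pred S) (F : S -> S -> R) x :
  laplacian c (fun w => \sum_(y | P y) F y w) x =
  \sum_(y | P y) laplacian c (F y) x.
Proof.
rewrite exchange_big/=; apply: eq_bigr => z _.
by rewrite -sumrB mulr_sumr.
Qed.

Hypotheses (h_ge0 : 0 <= h) (h_small : forall x, 0 <= 1 + h * Q x x).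

Let J_ge0 x y : 0 <= (x == y)%:R + h * Q x y.
Proof.
have [->//|xy] := eqVneq x y; rewrite add0r mulr_ge0//.
by rewrite -(pmulr_rge0 _ (pi_gt0 x)) Q_off.
Qed.

Lemma killed_ge0 n y : 0 <= killed n y.
Proof.
elim: n y => [|n IH] y /=; first exact: ler0n.
by case: ifP => // _; apply: sumr_ge0 => z _; rewrite mulr_ge0.
Qed.

(** The equilibrium potential: the chance to reach [u] before [v] from [y]. *)
Let ht y := k u y / k u u.

Let ht_ge0 y : 0 <= ht y.
Proof. by rewrite divr_ge0 ?ku_ge0// ltW. Qed.

Let ht_le1 y : ht y <= 1.
Proof.
by rewrite ler_pdivrMr// mul1r (green_le_diag c_sym c_ge0 resP (kP uv)).
Qed.

Let htu : ht u = 1. Proof. by rewrite /ht divff// gt_eqF. Qed.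

Let htv : ht v = 0. Proof. by rewrite /ht (kP uv).1 mul0r. Qed.

Let ht_lap y : y != v -> laplacian c ht y = (y == u)%:R / k u u.
Proof. by move=> yv; rewrite laplacian_scale (kP uv).2. Qed.

(* Reversibility turns occupation at [y] started from [u] into occupation of
   [u] started from [y], which is at most the chance to reach [u] before [v]. *)
Lemma killed_le n y : killed n y * pi u <= pi y * ht y.
Proof.
elim: n y => [|n IH] y.
  rewrite /=; have [->|yu] := eqVneq y u; first by rewrite htu mul1r mulr1.
  by rewrite mul0r mulr_ge0 ?ht_ge0 ?ltW.
rewrite /=; have [->|yv] := eqVneq y v; first by rewrite htv mul0r mulr0.
have Jrev z : pi z * ((z == y)%:R + h * Q z y) =
    pi y * ((y == z)%:R + h * Q y z).
  have [->//|zy] := eqVneq z y.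
  by rewrite !add0r !(mulrCA _ h) (Q_off zy) Q_off 1?c_sym// eq_sym.
rewrite mulr_suml.
(* [pi y * ht y] is its own Euler image plus a source, nonnegative because [ht] is superharmonic off
   [v]; so the bound survives a step. *)
have -> : pi y * ht y = \sum_z pi z * ht z * ((z == y)%:R + h * Q z y)
    + h * laplacian c ht y.
  have -> : \sum_z pi z * ht z * ((z == y)%:R + h * Q z y) =
      pi y * (ht y + h * \sum_z Q y z * ht z).
    rewrite mulrDr mulr_sumr mulr_sumr.
    have -> : pi y * ht y = \sum_z pi y * (y == z)%:R * ht z.
      rewrite (bigD1 y)//= eqxx mulr1 big1 ?addr0// => z zy.
      by rewrite eq_sym (negPf zy) mulr0 mul0r.
    rewrite -big_split/=; apply: eq_bigr => z _.
    by rewrite mulrAC Jrev; ring.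
  by rewrite generator_laplacian; field; rewrite gt_eqF.
rewrite -[leLHS]addr0; apply: lerD; last first.
  by rewrite mulr_ge0// ht_lap// divr_ge0 ?ler0n// ltW.
by apply: ler_sum => z _; rewrite mulrAC ler_wpM2r.
Qed.

Let wt n := \sum_y killed n y * ht y.

(** [ht] is harmonic except at [u] and [v], so [wt] decreases only through the mass at [u], at rate
    [kappa]. *)
Let wtS n : wt n.+1 = wt n - h * kappa * killed n u.
Proof.
rewrite /wt killed_dual//.
under eq_bigr do rewrite mulrBr; rewrite sumrB; congr (_ - _).
rewrite (bigD1 u)//= big1 => [|y yu]; last first.
  have [->|yv] := eqVneq y v; first by rewrite killed_v mul0r.
  by rewrite ht_lap// (negPf yu) !(mul0r, mulr0).
by rewrite ht_lap// eqxx addr0 /escape_rate invfM mul1r; ring.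
Qed.

(** By [killed_le] the mass at [y] is at most [pi y * ht y / pi u], the summand of [eps], whatever
    the time [n]. *)
Let killed_excursion n (g : S -> R) : (forall y, 0 <= g y <= 1) ->
  0 <= \sum_(y | y != u) killed n y * g y <= eps.
Proof.
move=> g01; apply/andP; split.
  by apply: sumr_ge0 => y _; rewrite mulr_ge0 ?killed_ge0//; case/andP: (g01 y).
apply: ler_sum => y _; have /andP[g0 g1] := g01 y.
rewrite (@le_trans _ _ (killed n y))//.
  by rewrite ler_piMr ?killed_ge0.
have -> : pi y * k u y / (pi u * k u u) = pi y * ht y / pi u.
  by rewrite /ht; field; rewrite !gt_eqF.
by rewrite ler_pdivlMr ?killed_le.
Qed.

Let wtE n : wt n = killed n u + \sum_(y | y != u) killed n y * ht y.
Proof. by rewrite /wt (bigD1 u)//= htu mulr1. Qed.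

Let wt_ge0 n : 0 <= wt n.
Proof. by apply: sumr_ge0 => y _; rewrite mulr_ge0 ?killed_ge0. Qed.

Let wt0 : wt 0 = 1.
Proof.
rewrite wtE /= eqxx big1 ?addr0// => y yu.
by rewrite (negPf yu) mul0r.
Qed.

Lemma escape_rate_le1 : h * kappa <= 1.
Proof.
have := wt_ge0 1; rewrite wtS wt0 /= eqxx mulr1.
by rewrite subr_ge0.
Qed.

Lemma killed_mass n :
  (1 - h * kappa) ^+ n <= \sum_y killed n y <= (1 - h * kappa) ^+ n + 2 * eps.
Proof.
have q0 : 0 <= 1 - h * kappa by rewrite subr_ge0 escape_rate_le1.
have hk0 : 0 <= h * kappa by rewrite mulr_ge0// ltW ?escape_rate_gt0.
have ht01 y : 0 <= ht y <= 1 by rewrite ht_ge0 ht_le1.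
(* [wt n.+1] is the convex combination, with weights [1 - h * kappa] and [h * kappa], of [wt n] and
   a number in [[0, eps]]; so errors do not accumulate. *)
have wtb : (1 - h * kappa) ^+ n <= wt n <= (1 - h * kappa) ^+ n + eps.
  elim: n => [|n /andP[IH1 IH2]].
    by rewrite expr0 wt0 lexx lerDl excursion_ratio_ge0.
  have /andP[r0 r1] := killed_excursion n ht01.
  have wE : wt n.+1 = (1 - h * kappa) * wt n
      + h * kappa * \sum_(y | y != u) killed n y * ht y.
    by rewrite wtS wtE; ring.
  rewrite exprS wE; apply/andP; split; first by nra.
  by nra.
have ht01' y : 0 <= 1 - ht y <= 1.
  by have /andP[? ?] := ht01 y; apply/andP; split; lra.
(* The factor [1 - ht] vanishes at [u], so the remaining mass is again excursion mass and costs a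
   second [eps]. *)
have sE : \sum_y killed n y = wt n + \sum_(y | y != u) killed n y * (1 - ht y).
  rewrite (bigD1 u)//= wtE -addrA -big_split/=; congr (_ + _).
  by apply: eq_bigr => y _; ring.
have /andP[r0 r1] := killed_excursion n ht01'.
by rewrite sE; case/andP: wtb => ? ?; apply/andP; split; lra.
Qed.

Lemma killed_occupation n :
  h * \sum_(i < n) \sum_y killed i y <= (1 + eps) / kappa.
Proof.
(* [z w] is the mean time to hit [v] from [w]. Its Laplacian is [pi] off [v], so an Euler step
   lowers its mean by [h] times the surviving mass, and the sum telescopes. *)
pose z w := \sum_(y | y != v) pi y * k y w.
have zv : z v = 0 by apply: big1 => y yv; rewrite (kP yv).1 mulr0.
have z_ge0 w : 0 <= z w.
  apply: sumr_ge0 => y yv; apply: mulr_ge0; first exact: ltW.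
  exact: (green_ge0 c_sym c_ge0 resP (kP yv)).
have zlap x : x != v -> laplacian c z x = pi x.
  move=> xv; rewrite /z laplacian_sum (bigD1 x)//= big1.
    rewrite addr0; under [LHS]eq_bigr do rewrite -mulrBr mulrCA.
    by rewrite -mulr_sumr -/(laplacian _ _ _) (kP xv).2// eqxx mulr1.
  move=> y /andP[yv yx]; rewrite /laplacian.
  under eq_bigr do rewrite -mulrBr mulrCA.
  by rewrite -mulr_sumr -/(laplacian _ _ _) (kP yv).2// eq_sym (negPf yx) mulr0.
have zS m : \sum_y killed m.+1 y * z y =
    \sum_y killed m y * z y - h * \sum_y killed m y.
  rewrite killed_dual// mulr_sumr -sumrB; apply: eq_bigr => y _.
  have [->|yv] := eqVneq y v; first by rewrite killed_v !(mul0r, mulr0) subr0.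
  by rewrite zlap// divff ?gt_eqF//; ring.
have zu : \sum_y killed 0 y * z y = (1 + eps) / kappa.
  rewrite (bigD1 u)//= eqxx mul1r big1 => [|y yu]; last first.
    by rewrite (negPf yu) mul0r.
  rewrite addr0 /z (bigD1 u)//= /escape_rate invrK mulrDl mul1r; congr (_ + _).
  rewrite mulr_suml [RHS](bigD1 v)/=; last by rewrite eq_sym.
  rewrite (kP uv).1 mulr0 !mul0r add0r.
  apply: eq_big => [y|y /andP[yv yu]]; first exact: andbC.
  rewrite (green_sym c_sym (kP yv) (kP uv)).
  by field; rewrite !gt_eqF.
rewrite -zu; suff -> : \sum_y killed 0 y * z y =
    h * \sum_(i < n) \sum_y killed i y + \sum_y killed n y * z y.
  by rewrite lerDl sumr_ge0// => y _; rewrite mulr_ge0 ?killed_ge0.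
elim: n => [|n IH]; first by rewrite big_ord0 mulr0 add0r.
by rewrite IH big_ord_recr/= (zS n); ring.
Qed.

End KilledWalk.

(** * The energy landscape *)

Section BipartiteGraph.
Import fintype boot.finset.
Variables (U V : finType) (E : U -> V -> bool).
Local Notation N := (neighbours E).

Lemma neighboursP (A : {set V}) a :
  reflect (exists2 b, b \in A & E a b) (a \in N A).
Proof. by rewrite inE; exact: exists_inP. Qed.

Lemma neighboursS (A B : {set V}) : A \subset B -> N A \subset N B.
Proof.
move=> /subsetP AB; apply/subsetP => a /neighboursP[b bA Eab].
by apply/neighboursP; exists b => //; exact: AB.
Qed.

Lemma neighboursU (A B : {set V}) : N (A :|: B) = N A :|: N B.
Proof.
apply/eqP; rewrite eqEsubset subUset !neighboursS ?subsetUl ?subsetUr ?andbT//.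
apply/subsetP => a /neighboursP[b]; rewrite !in_setU => /orP[bA|bB] Eab; apply/orP.
  by left; apply/neighboursP; exists b.
by right; apply/neighboursP; exists b.
Qed.

(** Submodularity before the overlap is estimated: [N A :&: N B] contains [N (A :&: B)] and may be
    larger, which matters when [A] and [B] are disjoint. *)
Lemma card_neighboursU (A B : {set V}) :
  (#|N (A :|: B)| + #|N A :&: N B| = #|N A| + #|N B|)%N.
Proof. by rewrite neighboursU cardsUI. Qed.

Definition site_set (W : {set U}) (A : {set V}) : {set U + V} :=
  [set k : U + V | match k with inl a => a \in W | inr b => b \in A end].

Definition Upart (x : {set U + V}) : {set U} := [set a | inl a \in x].
Definition Vpart (x : {set U + V}) : {set V} := [set b | inr b \in x].

Lemma Upart_site W A : Upart (site_set W A) = W.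
Proof. by apply/setP => a; rewrite !inE. Qed.

Lemma Vpart_site W A : Vpart (site_set W A) = A.
Proof. by apply/setP => a; rewrite !inE. Qed.

Lemma Upart_add (x : {set U + V}) k : Upart (k |: x) =
  match k with inl a => a |: Upart x | inr _ => Upart x end.
Proof. by case: k => k; apply/setP => a; rewrite !inE. Qed.

Lemma Vpart_add (x : {set U + V}) k : Vpart (k |: x) =
  match k with inl _ => Vpart x | inr b => b |: Vpart x end.
Proof. by case: k => k; apply/setP => b; rewrite !inE. Qed.

Lemma independentP (x : {set U + V}) :
  reflect (forall a b, inl a \in x -> inr b \in x -> ~~ E a b)
    (independent E x).
Proof.
apply: (iffP forall_inP) => [H a b ax bx|H [a|b] jx].
- by have /forall_inP/(_ _ bx) := H _ ax.
- by apply/forall_inP => -[a'|b'] //=; exact: H.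
- by apply/forall_inP => -[a'|b'] //= ax; exact: H.
Qed.

Lemma independent_disjoint (x : config E) a :
  a \in N (Vpart (val x)) -> inl a \notin val x.
Proof.
move=> /neighboursP[b]; rewrite inE => bx; apply: contraL => ax.
exact: (independentP _ (valP x)).
Qed.

Lemma independentS (x y : {set U + V}) : x \subset y ->
  independent E y -> independent E x.
Proof.
move=> /subsetP xy /independentP H; apply/independentP => a b ax bx.
by apply: H; exact: xy.
Qed.

Lemma independent_free (x : {set U + V}) k : k \notin x ->
  independent E (k |: x) -> free_site E x k.
Proof.
move=> kx /forall_inP H; rewrite /free_site kx; apply/forall_inP => j jx.
have jkx : j \in k |: x by rewrite in_setU jx orbT.
by have /forall_inP := H _ jkx; apply; rewrite setU11.
Qed.

Lemma independent_site (A B : {set V}) : A \subset B ->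
  independent E (site_set (~: N B) A).
Proof.
move=> AB; apply/independentP => a b; rewrite !inE => aN bA.
apply: contraNN aN => Eab; apply/exists_inP; exists b => //.
exact: (subsetP AB).
Qed.

(** The largest configuration whose [V]-part is [A]. *)
Definition full (A : {set V}) : config E :=
  Sub (site_set (~: N A) A) (independent_site (subxx A)).

(** The way station from [full A] to [full B]: the sites of [U] that block [B] are already
    vacated. *)
Definition narrowed (A B : {set V}) (AB : A \subset B) : config E :=
  Sub (site_set (~: N B) A) (independent_site AB).

Lemma sub_full (x : config E) : val x \subset val (full (Vpart (val x))).
Proof.
apply/subsetP => -[a|b] kx; rewrite /full SubK inE; last by rewrite inE.
by rewrite in_setC; apply: contraL kx => /independent_disjoint.
Qed.

Hypotheses (hconn : connected_graph E).

Lemma has_neighbourV : (0 < #|U|)%N -> forall b, exists a, E a b.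
Proof.
move=> /card_gt0P[a _] b.
have /connectP[[|k p]//= /andP[bk _] _] := hconn (inr b) (inl a).
by case: k bk => //= a' Eab; exists a'.
Qed.

Lemma has_neighbourU : (0 < #|V|)%N -> forall a, exists b, E a b.
Proof.
move=> /card_gt0P[b _] a.
have /connectP[[|k p]//= /andP[bk _] _] := hconn (inl a) (inr b).
by case: k bk => //= b' Eab; exists b'.
Qed.

(** Otherwise the sites of [A] and [N A] together would be closed under adjacency, against
    connectedness. *)
Lemma boundary_vertex (A : {set V}) : A != set0 -> A != [set: V] ->
  exists2 b, b \notin A & N [set b] :&: N A != set0.
Proof.
move=> /set0Pn[b0 b0A] AT.
have [b1 b1A] : exists b, b \notin A.
  by apply/existsP; apply: contraR AT => /existsPn H; apply/eqP/setP => b;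
    rewrite in_setT; have := H b; rewrite negbK.
apply: contrapT => H.
pose C : pred (U + V) :=
  fun k => match k with inl a => a \in N A | inr b => b \in A end.
have CC : fingraph.closed (Defs.adjacent E) C.
  apply: intro_closed.
    apply: sym_connect_sym => -[a|b] [a'|b'] //.
  move=> [a|b] [a'|b'] //= Eab; rewrite -!topredE /= => h.
    apply: contrapT => /negP b'A; apply: H; exists b' => //.
    apply/set0Pn; exists a; rewrite in_setI h andbT.
    by apply/neighboursP; exists b' => //; rewrite in_set1.
  by apply/neighboursP; exists b.
have := closed_connect CC (hconn (inr b0) (inr b1)).
by rewrite -!topredE /= b0A (negPf b1A).
Qed.

End BipartiteGraph.

(** * Reversible weights and conductances of the hard-core dynamics *)

Section Conductances.
Import fintype boot.finset.
Variables (R : realType) (U V : finType) (E : U -> V -> bool).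
Variables (lam beta : R).
Hypotheses (lam_ge1 : 1 <= lam) (beta_ge1 : 1 <= beta).
Local Notation lambar := (lam `^ beta).
Local Notation act := (activity lam lambar).
Local Notation N := (neighbours E).

Definition exponent (x : {set U + V}) : R :=
  #|Upart x|%:R + beta * #|Vpart x|%:R.

Definition weight (x : config E) : R := lam `^ exponent (val x).

Definition conductance (x y : config E) : R := weight x * jump_rate lam lambar x y.

Definition joins (m : R) : rel (config E) := [rel x y | m <= conductance x y].

Let lam_gt0 : 0 < lam. Proof. exact: lt_le_trans lam_ge1. Qed.
Let lam_ge0 : 0 <= lam. Proof. exact: ltW. Qed.

Lemma weight_gt0 x : 0 < weight x.
Proof. exact: powR_gt0. Qed.

Lemma lam_pow_le (s t : R) : s <= t -> lam `^ s <= lam `^ t.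
Proof. exact: ler_powR. Qed.

Lemma exponent_add (x : {set U + V}) k : k \notin x ->
  exponent (k |: x) = exponent x + (if is_inl k then 1 else beta).
Proof.
by case: k => [a|b] kx; rewrite /exponent Upart_add Vpart_add cardsU1 inE kx
  add1n -natr1 /=; ring.
Qed.

Lemma activityE (k : U + V) : act k = lam `^ (if is_inl k then 1 else beta).
Proof. by rewrite /activity; case: ifP; rewrite ?powRr1. Qed.

Lemma weight_add (x y : config E) k : k \notin val x -> val y = k |: val x ->
  weight y = weight x * act k.
Proof.
move=> kx yE; rewrite /weight yE exponent_add// activityE powRD//.
by rewrite (lt0r_neq0 lam_gt0) implybT.
Qed.

Lemma exponentS (x y : {set U + V}) : x \subset y -> exponent x <= exponent y.
Proof.
move=> /subsetP xy; rewrite lerD//.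
  by rewrite ler_nat subset_leq_card//; apply/subsetP => a; rewrite !inE => /xy.
rewrite ler_wpM2l// ?(le_trans ler01)// ler_nat subset_leq_card//.
by apply/subsetP => b; rewrite !inE => /xy.
Qed.

(* By detailed balance an edge has the weight of its larger endpoint. *)
Definition site_conductance (k : U + V) (x y : config E) : R :=
  if (k \notin val x) && (val y == k |: val x) then weight y
  else if (k \in val x) && (val y == val x :\ k) then weight x else 0.

Lemma conductanceE x y : conductance x y = \sum_k site_conductance k x y.
Proof.
rewrite /conductance /jump_rate mulr_sumr; apply: eq_bigr => k _.
rewrite /site_conductance; have [kx|kx] /= := boolP (k \in val x).
  by rewrite /free_site kx /=; case: ifP; rewrite ?mulr1 ?mulr0.
case: ifP => [/andP[_ yE]|]; rewrite ?yE ?(weight_add kx (eqP yE))//.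
case: eqP => [yE|]; rewrite ?andbF ?mulr0// andbT.
by rewrite independent_free// -yE; exact: (valP y).
Qed.

Lemma site_conductance_sym k x y : site_conductance k x y = site_conductance k y x.
Proof.
rewrite /site_conductance.
have H (a b : config E) : (k \notin val a) && (val b == k |: val a) =
    (k \in val b) && (val a == val b :\ k).
  apply/andP/andP => -[ka /eqP e].
    by rewrite e setU11 setU1K.
  by rewrite e setD11 setD1K.
rewrite -!H; case: ifP => [/andP[kx /eqP yE]|//].
by rewrite yE setU11.
Qed.

Lemma site_conductance_ge0 k x y : 0 <= site_conductance k x y.
Proof. by rewrite /site_conductance; do 2?case: ifP => _ //; exact/ltW/weight_gt0. Qed.

Lemma conductance_sym x y : conductance x y = conductance y x.
Proof.
by rewrite !conductanceE; apply: eq_bigr => k _; exact: site_conductance_sym.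
Qed.

Lemma conductance_ge0 x y : 0 <= conductance x y.
Proof.
by rewrite conductanceE sumr_ge0// => k _; exact: site_conductance_ge0.
Qed.

Lemma conductance_add (x y : config E) k : k \notin val x ->
  val y = k |: val x -> weight y <= conductance x y.
Proof.
move=> kx yE; rewrite conductanceE (bigD1 k)//= {1}/site_conductance kx yE eqxx.
by rewrite lerDl sumr_ge0// => j _; exact: site_conductance_ge0.
Qed.

Lemma conductance_le (x y : config E) (b : R) : 0 <= b ->
  (forall k, k \notin val x -> val y = k |: val x -> weight y <= b) ->
  (forall k, k \notin val y -> val x = k |: val y -> weight x <= b) ->
  conductance x y <= #|{: U + V}|%:R * b.
Proof.
move=> b0 H1 H2; rewrite conductanceE mulr_natl -sumr_const.
apply: ler_sum => k _; rewrite /site_conductance; case: ifP => [/andP[kx /eqP yE]|_].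
  exact: H1 kx yE.
case: ifP => [/andP[kx /eqP yE]|//]; apply: (H2 k).
  by rewrite yE setD11.
by rewrite yE setD1K.
Qed.

Lemma joins_sym m : connect_sym (joins m).
Proof. by apply: sym_connect_sym => x y; rewrite /joins /= conductance_sym. Qed.

(** Sites are added one by one. As activities are at least 1 the weight only grows, so adding [k]
    later is at least as heavy as adding it to [x]. *)
Lemma joins_subset (m : R) (x y : config E) : val x \subset val y ->
  (forall k, k \in val y :\: val x -> m <= weight x * act k) ->
  connect (joins m) x y.
Proof.
have [n] := ubnP #|val y :\: val x|; elim: n x => // n IH x.
rewrite ltnS => yxn xy mk.
have [yx0|/set0Pn[k]] := eqVneq (val y :\: val x) set0.
  suff -> : x = y by exact: connect0.
  by apply/val_inj/eqP; rewrite eqEsubset xy -setD_eq0 yx0 eqxx.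
rewrite inE => /andP[kx ky].
have kxy : k |: val x \subset val y by rewrite subUset sub1set ky.
pose z : config E := Sub (k |: val x) (independentS kxy (valP y)).
have zE : val z = k |: val x by rewrite SubK.
have xz : m <= weight z by rewrite (weight_add kx zE) mk// inE kx.
apply: (@connect_trans _ _ z).
  by apply: connect1; rewrite /joins /= (le_trans xz)// (conductance_add kx).
apply: IH; rewrite ?zE//.
  apply: leq_trans yxn; apply: proper_card; apply/properP; split.
    by apply: setDS; exact: subsetU1.
  by exists k; rewrite !inE ?kx// eqxx.
move=> j; rewrite !inE negb_or -andbA => /and3P[jk jx jy].
apply: (@le_trans _ _ (weight x * act j)); first by rewrite mk// !inE jx.
rewrite ler_wpM2r//; first by rewrite activityE powR_ge0.
by apply: lam_pow_le; apply: exponentS; rewrite zE subsetU1.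
Qed.

Lemma generator_off x y : x != y ->
  weight x * hardcore_generator lam lambar x y = conductance x y.
Proof. by rewrite /hardcore_generator => /negPf->. Qed.

Lemma generator_row (x : config E) :
  \sum_y hardcore_generator lam lambar x y = 0.
Proof.
rewrite (bigD1 x)//= {1}/hardcore_generator eqxx addrC -sumrB big1// => y yx.
by rewrite /hardcore_generator eq_sym (negPf yx) subrr.
Qed.

End Conductances.

(** * Isoperimetric numberings as paths to [v] *)

Section Isoperimetry.
Import fintype boot.finset.
Variables (R : realType) (U V : finType) (E : U -> V -> bool).
Local Notation N := (neighbours E).
Local Notation Delta s := ((min_deficit E s)%:~R : R).

Lemma min_deficit_le (A : {set V}) : Delta #|A| + #|A|%:R <= #|N A|%:R.
Proof.
rewrite -lerBrDr !pmulrn -intrB ler_int.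
by apply: (@bigmin_le_cond _ _ _ _ A) => /=.
Qed.

Lemma optimal_card (A : {set V}) : isoperimetrically_optimal E A ->
  #|N A|%:R = Delta #|A| + #|A|%:R.
Proof. by move=> <-; rewrite /deficit intrB !pmulrn subrK. Qed.

Definition prefix (s : seq V) (j : nat) : {set V} := [set b in take j s].

Lemma card_prefix s j : uniq s -> (j <= size s)%N -> #|prefix s j| = j.
Proof.
move=> us js; rewrite cardsE; have /card_uniqP -> := take_uniq j us.
by rewrite size_takel.
Qed.

Lemma prefixS s j x0 : (j < size s)%N -> prefix s j.+1 = nth x0 s j |: prefix s j.
Proof.
move=> js; by apply/setP => b; rewrite !inE (take_nth x0)// mem_rcons in_cons.
Qed.

Variables (alpha delta Gamma : R) (s0 : nat).
Hypotheses (s0_range : (1 <= s0 <= #|V|)%N) (s0P : Delta s0 <= alpha * s0%:R).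
Hypotheses (delta_range : 0 < delta <= 1)
  (gap : forall i, (1 <= i < s0)%N -> alpha * i%:R + delta <= Delta i)
  (GammaP : forall j, (1 <= j <= s0)%N -> gain E alpha j <= Gamma).
Hypothesis numbering : forall a : V, exists s : seq V,
  [/\ isoperimetric_numbering E s, (s0 <= size s)%N & ohead s = Some a].

Lemma Gamma_ge0 : (0 < #|V|)%N -> (forall b, exists a, E a b) -> 0 <= Gamma.
Proof.
move=> /card_gt0P[b _] hV; apply: le_trans (GammaP (j := 1%N) _); last first.
  by rewrite leqnn/=; case/andP: s0_range.
rewrite /gain subrr mulr0 subr0.
have [s [[us opt] s0s hs]] := numbering b.
have s1 : (1 <= size s)%N by apply: leq_trans s0s; case/andP: s0_range.
have := optimal_card (opt 1%N s1); rewrite (card_prefix us s1) => h.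
have [a Eab] := hV b.
have : (1 <= #|N [set b in take 1 s]|)%N.
  apply/card_gt0P; exists a; apply/neighboursP; exists b => //.
  by rewrite inE; case: (s) hs => //= x t [->]; rewrite take0 mem_seq1.
rewrite -(ler_nat R) h; lra.
Qed.

(* Disjoint [A] and [B] still share a neighbour, which pays for [delta <= 1];
   otherwise the neighbourhood of [A :&: B] does. *)
Lemma overlap (A B : {set V}) : (#|A :&: B| < s0)%N -> N A :&: N B != set0 ->
  (1 + alpha) * #|A :&: B|%:R + delta <= #|N A :&: N B|%:R.
Proof.
move=> is0 NAB; have [->|i0] := posnP #|A :&: B|.
  rewrite mulr0 add0r; case/andP: delta_range => _ /le_trans; apply.
  by rewrite ler1n card_gt0.
have : #|N (A :&: B)|%:R <= #|N A :&: N B|%:R :> R.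
  rewrite ler_nat subset_leq_card// subsetI !neighboursS ?subsetIl//.
  exact: subsetIr.
have := min_deficit_le (A :&: B).
have := gap (i := #|A :&: B|); rewrite i0 is0 => /(_ isT).
lra.
Qed.

(** Optimality gives the size of [N (prefix s j)], and [overlap] bounds from below what it shares
    with [N A]. *)
Lemma growth_count (A : {set V}) (s : seq V) (j : nat) :
  isoperimetric_numbering E s -> (1 <= j <= size s)%N ->
  (#|A :&: prefix s j| < s0)%N ->
  N A :&: N (prefix s j) != set0 ->
  #|N (A :|: prefix s j)|%:R <= #|N A|%:R + Delta j + j%:R
    - (1 + alpha) * #|A :&: prefix s j|%:R - delta.
Proof.
move=> [us opt] js is0 NN; have := overlap is0 NN.
have := optimal_card (opt j js); rewrite card_prefix//; last by case/andP: js.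
have := congr1 (fun n => n%:R : R) (card_neighboursU E A (prefix s j)).
rewrite !natrD => h1 h2 h3; rewrite -/(prefix s j) in h2; lra.
Qed.

Variables (lam eta theta : R).
Local Notation beta := (1 + alpha + eta).
Hypotheses (lam_ge1 : 1 <= lam) (beta_ge1 : 1 <= beta)
  (etaP : `|eta| * #|V|%:R <= theta) (theta_le : theta <= delta).
Hypotheses (U_gt0 : (0 < #|U|)%N) (V_gt0 : (0 < #|V|)%N)
  (hconn : connected_graph E).

Local Notation lambar := (lam `^ beta).
Local Notation act := (activity lam lambar).
Local Notation expo := (exponent beta).
Local Notation mu := (weight lam beta).
Local Notation joins := (joins lam beta).

Let lam_le_lambar : lam <= lambar.
Proof. by rewrite -[leLHS](powRr1 (le_trans ler01 lam_ge1)) lam_pow_le. Qed.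

(** [theta] absorbs the o(1) error of the activity exponent. *)
Let eta_le (m : R) : 0 <= m <= #|V|%:R -> - theta <= eta * m <= theta.
Proof.
move=> /andP[m0 mV]; rewrite -ler_norml normrM (ger0_norm m0).
by apply: le_trans etaP; rewrite ler_wpM2l.
Qed.

Lemma expo_site (W : {set U}) (A : {set V}) :
  expo (site_set W A) = #|W|%:R + beta * #|A|%:R.
Proof. by rewrite /exponent Upart_site Vpart_site. Qed.

Lemma expo_setC (A B : {set V}) :
  expo (site_set (~: N B) A) = #|U|%:R - #|N B|%:R + beta * #|A|%:R.
Proof. by rewrite expo_site -(cardsC (N B)) natrD; ring. Qed.

(** Vacate the neighbours of [B], then place [b]. The lowest configuration on the way is [narrowed],
    and the larger endpoint of each edge has at least one more particle, whence the extra 1 in the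
    exponent. *)
Lemma joins_step (A B : {set V}) (b : V) (m : R) : b \notin A -> B = b |: A ->
  m <= lam `^ (expo (site_set (~: N B) A) + 1) ->
  connect (joins m) (full E A) (full E B).
Proof.
move=> bA BE mle; have AB : A \subset B by rewrite BE subsetU1.
have wE : val (narrowed E AB) = site_set (~: N B) A by rewrite SubK.
have mul : m <= mu (narrowed E AB) * lam.
  apply: le_trans mle _; rewrite /weight wE powRD ?powRr1//.
    exact: le_trans lam_ge1.
  by rewrite (lt0r_neq0 (lt_le_trans ltr01 lam_ge1)) implybT.
apply: (@connect_trans _ _ (narrowed E AB)); last first.
  apply: joins_subset => //.
    by rewrite wE SubK; apply/subsetP => -[a|c]; rewrite !inE// => /(subsetP AB).
  rewrite wE SubK => -[a|c] _; first exact: mul.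
  apply: le_trans mul _; rewrite ler_wpM2l//; exact: powR_ge0.
rewrite joins_sym//; apply: joins_subset => //.
  rewrite wE SubK; apply/subsetP => -[a|c]; rewrite !inE// => aN.
  apply: contraNN aN => /exists_inP[c cA Eac].
  by apply/exists_inP; exists c => //; exact: (subsetP AB).
rewrite wE SubK => -[a|c]; first by move=> _; exact: mul.
by rewrite !inE andNb.
Qed.

(** [B] adds to [A] the first [s0] sites of a numbering starting at a site outside [A] that shares a
    neighbour with [A]. Since this neighbour is shared from the first site on, every stage saves
    [delta]. *)
Lemma growth (A : {set V}) : A != set0 -> A != [set: V] ->
  exists B : {set V}, [/\ A \proper B,
    expo (val (full E A)) <= expo (val (full E B)) &
    forall m, m <= lam `^ (expo (val (full E A)) - Gamma + delta - theta) ->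
      connect (joins m) (full E A) (full E B)].
Proof.
move=> A0 AT; have [a aA NaA] := boundary_vertex hconn A0 AT.
have [s [num s0s hs]] := numbering a; have [us _] := num.
have /andP[s01 s0V] := s0_range.
have a_prefix j : (1 <= j)%N -> a \in prefix s j.
  by case: j => // j _; rewrite inE; case: (s) hs => //= x t [->]; rewrite mem_head.
have capN j : (1 <= j)%N -> N A :&: N (prefix s j) != set0.
  move=> j1; have /set0Pn[k] := NaA; rewrite inE => /andP[kNa kNA].
  apply/set0Pn; exists k; rewrite inE kNA/=.
  by apply: (subsetP (neighboursS E _)) kNa; rewrite sub1set a_prefix.
have capI j : (1 <= j <= s0)%N -> (#|A :&: prefix s j| < j)%N.
  move=> /andP[j1 js]; rewrite -[X in (_ < X)%N](card_prefix us (leq_trans js s0s)).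
  apply: proper_card; apply/properP; split; first exact: subsetIr.
  by exists a; [exact: a_prefix|rewrite inE (negPf aA)].
have capS0 j : (1 <= j <= s0)%N -> (#|A :&: prefix s j| < s0)%N.
  by move=> /[dup] /capI h /andP[_]; exact: leq_trans.
have cardU j : (j <= s0)%N ->
    #|A :|: prefix s j|%:R = #|A|%:R + j%:R - #|A :&: prefix s j|%:R :> R.
  move=> js; have := cardsUI A (prefix s j).
  rewrite (card_prefix us (leq_trans js s0s)).
  by move=> /(congr1 (fun n => n%:R : R)); rewrite !natrD => h; lra.
have count j : (1 <= j <= s0)%N -> #|N (A :|: prefix s j)|%:R <=
    #|N A|%:R + Delta j + j%:R - (1 + alpha) * #|A :&: prefix s j|%:R - delta.
  move=> js; apply: growth_count => //; last by apply: capN; case/andP: js.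
    by case/andP: js => -> /leq_trans; exact.
  exact: capS0.
exists (A :|: prefix s s0); split.
- apply/properP; split; first exact: subsetUl.
  by exists a => //; rewrite inE a_prefix ?orbT.
(* The terms [(1 + alpha) * i] cancel: the exponent grows by at least
   [alpha * s0 - Delta s0 + delta - theta], which is nonnegative. *)
- rewrite /full !SubK !expo_setC cardU//.
  have := count s0; rewrite s01 leqnn => /(_ isT).
  have := capI s0; rewrite s01 leqnn => /(_ isT) /ltnW; rewrite -(ler_nat R).
  set i := #|A :&: _|%:R => is0 h.
  have := @eta_le (s0%:R - i); rewrite subr_ge0 is0 /=.
  have -> : s0%:R - i <= #|V|%:R.
    have : s0%:R <= #|V|%:R :> R by rewrite ler_nat.
    have : 0 <= i by rewrite /i ler0n.
    lra.
  move=> /(_ isT) /andP[he _]; move: s0P theta_le h; lra.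
move=> m mle.
suff H j : (j <= s0)%N -> connect (joins m) (full E A) (full E (A :|: prefix s j)).
  exact: H.
elim: j => [|j IH] js.
  have -> : A :|: prefix s 0 = A by apply/setP => b; rewrite !inE take0 orbF.
  exact: connect0.
apply: connect_trans (IH (ltnW js)) _.
have pS := prefixS a (leq_trans js s0s); set b := nth a s j in pS.
have [bA|bA] := boolP (b \in A :|: prefix s j).
  have -> : A :|: prefix s j.+1 = A :|: prefix s j; last exact: connect0.
  by rewrite pS setUCA; apply/setUidPr; rewrite sub1set.
apply: (joins_step bA); first by rewrite pS setUCA.
apply: le_trans mle _; apply: lam_pow_le => //.
rewrite /full SubK !expo_setC.
have cardS : #|A :|: prefix s j|%:R = #|A|%:R + j%:R - #|A :&: prefix s j.+1|%:R :> R.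
  have := cardU _ js; rewrite pS setUCA cardsU1 bA add1n -!natr1 => h.
  by move: h; lra.
rewrite cardS.
have := count j.+1 js; have := capI j.+1 js; rewrite ltnS -(ler_nat R).
set i := #|A :&: _|%:R => ij h.
have := @eta_le (j%:R - i); rewrite subr_ge0 ij /=.
have -> : j%:R - i <= #|V|%:R.
  have : j%:R <= #|V|%:R :> R by rewrite ler_nat (leq_trans (ltnW js)).
  have : 0 <= i by rewrite /i ler0n.
  lra.
move=> /(_ isT) /andP[he _].
(* The neighbours of [j + 1] sites are vacated while only [j] of the sites count as placed; the
   balance is [Delta j.+1 - alpha * j], the gain at [j.+1]. *)
have := GammaP (j := j.+1) js; rewrite /gain -natr1; move: h; rewrite -natr1; lra.
Qed.

Lemma full_setT : full E [set: V] = config_v E.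
Proof.
apply: val_inj; rewrite /full !SubK; apply/setP => -[a|b]; rewrite !inE//.
apply/negbTE; rewrite negbK; apply/exists_inP.
by have [b Eab] := has_neighbourU hconn V_gt0 a; exists b.
Qed.

(** Repeated growth: the exponents of the full configurations do not decrease, so the threshold
    stays valid until [A] is all of [V]. *)
Lemma joins_full (A : {set V}) m : A != set0 ->
  m <= lam `^ (expo (val (full E A)) - Gamma + delta - theta) ->
  connect (joins m) (full E A) (config_v E).
Proof.
have [n] := ubnP #|~: A|; elim: n A => // n IH A; rewrite ltnS => An A0 mle.
have [->|AT] := eqVneq A [set: V]; first by rewrite full_setT connect0.
have [B [AB expoAB step]] := growth A0 AT.
apply: connect_trans (step m mle) _; apply: IH.
- apply: leq_trans An; apply: proper_card; rewrite properE !setCS.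
  by rewrite -properE.
- by apply: contraTneq AB => ->; rewrite properE negb_and negbK sub0set orbT.
- by apply: le_trans mle _; apply: lam_pow_le => //; lra.
Qed.

Let theta_ge0 : 0 <= theta.
Proof. by apply: le_trans etaP; rewrite mulr_ge0. Qed.

(** First the unblocked sites of [U] are filled, along edges heavier than [y] by at least a factor
    [lam], which suffices as [Gamma >= 0] and [delta <= 1]; then [joins_full] applies. *)
Lemma no_trap (y : config E) : Vpart (val y) != set0 ->
  connect (joins (lam `^ (expo (val y) - Gamma + delta - theta))) y (config_v E).
Proof.
move=> y0; set m := lam `^ _.
have G0 := Gamma_ge0 V_gt0 (has_neighbourV hconn U_gt0).
apply: (@connect_trans _ _ (full E (Vpart (val y)))); last first.
  apply: joins_full => //; apply: lam_pow_le => //; rewrite !lerD2r.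
  apply: exponentS => //; exact: sub_full.
apply: joins_subset => //; first exact: sub_full.
move=> k _; apply: (@le_trans _ _ (lam `^ (expo (val y) + 1))).
  by apply: lam_pow_le => //; have := theta_ge0; case/andP: delta_range => _; lra.
rewrite powRD ?(lt0r_neq0 (lt_le_trans ltr01 lam_ge1)) ?implybT//.
rewrite powRr1 ?(le_trans ler01 lam_ge1)// ler_wpM2l ?powR_ge0//.
by rewrite /activity; case: ifP.
Qed.

Lemma joins_one (x : config E) : connect (joins 1) x (config_v E).
Proof.
have i0 : independent E set0 by apply/independentP => a b; rewrite inE.
pose e : config E := Sub set0 i0.
have e0 : expo (val e) = 0.
  have H (T : finType) (f : T -> U + V) : [set t | f t \in (set0 : {set U + V})] = set0.
    by apply/setP => t; rewrite !inE.
  by rewrite /exponent SubK /Upart /Vpart !H !cards0 mulr0 addr0.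
suff H z : connect (joins 1) e z.
  by apply: (@connect_trans _ _ e) (H _); rewrite joins_sym//; exact: H.
apply: joins_subset => //; first by rewrite SubK sub0set.
move=> k _; rewrite /weight e0 powRr0 mul1r /activity.
by case: ifP => // _; exact: le_trans lam_le_lambar.
Qed.

(** * The bottleneck and the excursion ratio *)

Variable s1 : nat.
Hypotheses (s1_range : (1 <= s1 <= s0)%N) (s1P : gain E alpha s1 = Gamma).

(* The far side of the bottleneck: at least [s1] sites of [V] are occupied, or
   [s1 - 1] of them with room for one more. *)
Definition past (x : config E) : bool :=
  [exists D : {set V}, [&& #|D| == s1, (#|D :\: Vpart (val x)| <= 1)%N
    & [disjoint N D & Upart (val x)]]].

Lemma disjoint_parts (x : config E) (D : {set V}) : D \subset Vpart (val x) ->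
  [disjoint N D & Upart (val x)].
Proof.
move=> Dx; apply/pred0P => a /=; apply/negbTE/negP => /andP[aN].
by rewrite inE; apply/negP/independent_disjoint; exact: (subsetP (neighboursS E Dx)).
Qed.

Lemma past_card (x : config E) : (s1 <= #|Vpart (val x)|)%N -> past x.
Proof.
move=> s1x; pose D := [set b in take s1 (enum (Vpart (val x)))].
have DV : D \subset Vpart (val x).
  by apply/subsetP => b; rewrite inE => /mem_take; rewrite mem_enum.
apply/existsP; exists D; rewrite disjoint_parts// andbT.
have -> : D :\: Vpart (val x) = set0 by apply/eqP; rewrite setD_eq0.
rewrite cards0 andbT cardsE.
have /card_uniqP -> := take_uniq s1 (enum_uniq (Vpart (val x))).
by rewrite size_takel// -cardE.
Qed.

Lemma past_v : past (config_v E).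
Proof.
apply: past_card; have -> : Vpart (val (config_v E)) = [set: V].
  by apply/setP => b; rewrite /config_v SubK !inE.
case/andP: s1_range => _ /leq_trans; apply; rewrite cardsT.
by case/andP: s0_range.
Qed.

Lemma past_u : ~~ past (config_u E).
Proof.
apply/existsP => -[D /and3P[/eqP Ds _ /pred0P dis]].
have /card_gt0P[b bD] : (0 < #|D|)%N by rewrite Ds; case/andP: s1_range.
have [a Eab] := has_neighbourV hconn U_gt0 b.
have := dis a; rewrite /= !inE  /= andbT => /negbT/negP; apply.
by apply/exists_inP; exists b.
Qed.

(** The larger endpoint [y] has at most [s1 - 1] sites of [V], and at most one site of [U] beyond a
    set avoiding [N D] with [#|D| = s1]. This gives the exponent [#|U| - gain s1], up to [theta]. *)
Lemma cut_exponent (x y : config E) k : k \notin val x -> val y = k |: val x ->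
  past x != past y -> expo (val y) <= #|U|%:R - Gamma + theta.
Proof.
move=> kx yE pxy.
have UyE := Upart_add (val x) k; have VyE := Vpart_add (val x) k.
rewrite -yE in UyE VyE.
have Uxy : Upart (val x) \subset Upart (val y).
  by rewrite UyE; case: (k) => // a; exact: subsetU1.
have Uy : (#|Upart (val y)| <= #|Upart (val x)|.+1)%N.
  by rewrite UyE; case: (k) => // a; rewrite cardsU1; case: (_ \notin _).
(* With [s1] sites of [V] occupied in [y], both endpoints would be past, since [x] lacks at most one
   of them. *)
have Vy : (#|Vpart (val y)| < s1)%N.
  rewrite ltnNge; apply: contraNN pxy => s1y; rewrite (past_card s1y).
  apply/eqP; have [/past_card->//|xs1] := leqP s1 #|Vpart (val x)|.
  move: VyE; case: (k) => [a|b] VyE; first by rewrite VyE leqNgt xs1 in s1y.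
  apply/existsP; exists (Vpart (val y)); apply/and3P; split.
  - rewrite eqn_leq s1y andbT VyE cardsU1.
    by apply: leq_trans xs1; rewrite -add1n leq_add2r; case: (_ \notin _).
  - rewrite VyE setDUl setDv setU0 (leq_trans (subset_leq_card (subsetDl _ _)))//.
    by rewrite cards1.
  - by apply: disjointWr Uxy _; exact: disjoint_parts.
have [D /and3P[/eqP Ds _ Ddis]] : exists D : {set V}, [&& #|D| == s1, true
    & [disjoint N D & Upart (val x)]].
  move: pxy; case: (boolP (past x)) => [/existsP[D /and3P[? _ ?]] _|_].
    by exists D; apply/and3P.
  case: (boolP (past y)) => // /existsP[D /and3P[? _ dis]] _; exists D.
  by apply/and3P; split=> //; apply: disjointWr dis.
have NU : (#|N D| + #|Upart (val x)| <= #|U|)%N.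
  by move: Ddis; rewrite -leq_card_setU => /eqP <-; exact: max_card.
have ND := min_deficit_le D; rewrite Ds in ND.
have NUr : #|N D|%:R + #|Upart (val y)|%:R <= #|U|%:R + 1 :> R.
  rewrite -natrD natr1 ler_nat.
  apply: leq_trans (_ : (#|N D| + #|Upart (val x)|.+1 <= _)%N).
    by rewrite leq_add2l.
  by rewrite addnS ltnS.
have Vyr : beta * #|Vpart (val y)|%:R <= beta * (s1%:R - 1).
  rewrite ler_wpM2l ?(le_trans ler01 beta_ge1)//.
  by rewrite lerBrDr natr1 ler_nat.
have := @eta_le (s1%:R - 1); have /andP[s11 s1s0] := s1_range.
rewrite subr_ge0 ler1n s11 /=.
have -> : s1%:R - 1 <= #|V|%:R :> R.
  have : s1%:R <= #|V|%:R :> R.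
    by rewrite ler_nat (leq_trans s1s0)//; case/andP: s0_range.
  lra.
move=> /(_ isT)/andP[_ he].
rewrite /exponent -s1P /gain; lra.
Qed.

Local Notation cond := (conductance lam beta).

(** The test function for the Dirichlet principle: only edges across the cut contribute, each
    bounded by [cut_exponent]. *)
Lemma cut_energy (f := fun x : config E => (~~ past x)%:R : R) :
  energy cond f f <=
  #|{: config E}|%:R ^+ 2 * (#|{: U + V}|%:R * lam `^ (#|U|%:R - Gamma + theta)).
Proof.
set b := lam `^ _; have b0 : 0 <= b by exact: powR_ge0.
rewrite energyE; last exact: conductance_sym.
have le1 x z : cond x z * ((f x - f z) * (f x - f z)) <= #|{: U + V}|%:R * b.
  have [pxz|pxz] := eqVneq (past x) (past z).
    by rewrite /f pxz subrr mulr0 mulr0 mulr_ge0.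
  have -> : (f x - f z) * (f x - f z) = 1.
    by rewrite /f; move: pxz; case: (past x); case: (past z) => //= _; ring.
  rewrite mulr1; apply: conductance_le => // k kx zE; apply: lam_pow_le => //.
    exact: cut_exponent kx zE pxz.
  by apply: cut_exponent kx zE _; rewrite eq_sym.
apply: (@le_trans _ _ (\sum_(x : config E) \sum_(z : config E) (#|{: U + V}|%:R * b))).
  rewrite -[leRHS]mul1r; apply: ler_pM; rewrite ?invr_ge0//.
  - do 2 apply: sumr_ge0 => ? _; rewrite mulr_ge0 ?conductance_ge0//.
    by rewrite -expr2 sqr_ge0.
  - by rewrite invf_le1// ler1n.
  - by apply: ler_sum => x _; apply: ler_sum => z _; exact: le1.
rewrite sumr_const sumr_const -[leLHS]mulr_natl.
by rewrite expr2 -mulrA [X in _ <= _ * X]mulr_natl.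
Qed.

(** Without particles on [V] the value only has to be finite: there [excursion_small] compares with
    [g u u] instead. *)
Definition resistance (y : config E) : R := #|{: config E}|%:R ^+ 2 /
  (if Vpart (val y) == set0 then 1
   else lam `^ (expo (val y) - Gamma + delta - theta)).

Lemma resistanceP (f : config E -> R) y : f (config_v E) = 0 ->
  f y ^+ 2 <= resistance y * energy cond f f.
Proof.
move=> fv; rewrite -[f y]subr0 -fv; apply: connect_resistance.
- exact: conductance_sym.
- exact: conductance_ge0.
- by case: ifP => // _; rewrite powR_gt0// (lt_le_trans ltr01).
- by case: ifPn => [_|y0]; [exact: joins_one|exact: no_trap].
Qed.

Lemma config_uv : config_u E != config_v E.
Proof.
have /card_gt0P[a _] := U_gt0.
apply/eqP => /(congr1 (fun x : config E => inl a \in val x)).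
by rewrite /config_u /config_v !SubK !inE.
Qed.

Lemma expo_u : expo (val (config_u E)) = #|U|%:R.
Proof.
rewrite /exponent; have -> : Upart (val (config_u E)) = [set: U].
  by apply/setP => b; rewrite /config_u SubK !inE.
have -> : Vpart (val (config_u E)) = set0.
  by apply/setP => b; rewrite /config_u SubK !inE.
by rewrite cardsT cards0 mulr0 addr0.
Qed.

Lemma excursion_small (g : config E -> config E -> R) : 2 * theta <= delta ->
  (forall y, y != config_v E -> is_green cond (config_v E) y (g y)) ->
  excursion_ratio (config_u E) (@weight R U V E lam beta) g <=
  #|{: config E}|%:R * (#|{: config E}|%:R ^+ 4 * #|{: U + V}|%:R + 1)
    * lam `^ (2 * theta - delta).
Proof.
move=> theta2 gP; set u := config_u E; set v := config_v E.
set n : R := #|{: config E}|%:R; set c : R := #|{: U + V}|%:R.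
have uv : u != v := config_uv.
have csym := conductance_sym (E := E) beta lam_ge1.
have cge0 := conductance_ge0 (E := E) beta lam_ge1.
have guu : 0 < g u u := green_diag_gt0 csym cge0 resistanceP uv (gP u uv).
have mu0 x := weight_gt0 (E := E) beta lam_ge1 x.
set L := lam `^ _; have L0 : 0 <= L by exact: powR_ge0.
have n0 : 0 <= n by exact: ler0n.
have c0 : 0 <= c by exact: ler0n.
have nc0 : 0 <= n ^+ 4 * c by rewrite mulr_ge0 ?exprn_ge0.
have lam0 : lam != 0 by rewrite (lt0r_neq0 (lt_le_trans ltr01 lam_ge1)).
have pD a b : lam `^ a * lam `^ b = lam `^ (a + b) by rewrite powRD// lam0 implybT.
have pV a : (lam `^ a)^-1 = lam `^ (- a) by rewrite powRN.
have term y : y != u -> mu y * g u y / (mu u * g u u) <= (n ^+ 4 * c + 1) * L.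
  move=> yu; have [->|yv] := eqVneq y v.
    by rewrite (gP u uv).1 mulr0 mul0r mulr_ge0// addr_ge0.
  (* Without particles on [V] the kernel is at most [g u u], and a missing site of [U] costs a
     factor [lam], enough since [delta <= 1]. *)
  have [y0|y0] := eqVneq (Vpart (val y)) set0.
    have gle : g u y <= g u u := green_le_diag csym cge0 resistanceP (gP u uv) y.
    have yU : expo (val y) <= #|U|%:R - 1.
      rewrite /exponent y0 cards0 mulr0 addr0 lerBrDr natr1 ler_nat -cardsT.
      apply: proper_card; rewrite properT; apply: contraNneq yu => yU.
      apply/eqP/val_inj; rewrite /u /config_u SubK; apply/setP => -[a|b].
        by have := in_setT a; rewrite -yU !inE.
      by have := in_set0 b; rewrite -y0 !inE.
    apply: (@le_trans _ _ (mu y / mu u)).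
      rewrite invfM mulrA -mulrA mulrACA -[leRHS]mulr1 ler_pM2l ?divr_gt0//.
      by rewrite ler_pdivrMr// mul1r.
    apply: (@le_trans _ _ L); last by rewrite ler_peMl// lerDr.
    rewrite /weight expo_u pV pD; apply: lam_pow_le => //.
    by have := theta_ge0; case/andP: delta_range => _; move: yU; lra.
  have gle : g u y <= resistance y.
    rewrite -(green_sym csym (gP y yv) (gP u uv)).
    apply: le_trans (green_le_diag csym cge0 resistanceP (gP y yv) u) _.
    exact: (green_diag_le csym cge0 resistanceP yv (gP y yv)).
  have guuV : (g u u)^-1 <= n ^+ 2 * (c * lam `^ (#|U|%:R - Gamma + theta)).
    apply: le_trans cut_energy; rewrite -div1r ler_pdivrMr// mulrC.
    apply: (green_diag_ge csym cge0 (gP u uv)).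
      by rewrite past_v.
    by rewrite past_u.
  apply: (@le_trans _ _ (n ^+ 4 * c * L)); last by rewrite ler_wpM2r// lerDl.
  (* The weight of [y] cancels against its resistance and that of [u] against the cut: the remaining
     exponents are [Gamma - delta + theta] and [theta - Gamma]. *)
  have -> : n ^+ 4 * c * L = mu y * resistance y *
      ((mu u)^-1 * (n ^+ 2 * (c * lam `^ (#|U|%:R - Gamma + theta)))).
    rewrite /resistance (negPf y0) /weight expo_u !pV.
    have -> : L = lam `^ (expo (val y)) *
        lam `^ (- (expo (val y) - Gamma + delta - theta)) *
        (lam `^ (- #|U|%:R) * lam `^ (#|U|%:R - Gamma + theta)).
      by rewrite !pD /L; congr (_ `^ _); ring.
    by rewrite /n; ring.
  rewrite invfM; apply: ler_pM.
  - by rewrite mulr_ge0 ?(ltW (mu0 y))// (green_ge0 csym cge0 resistanceP (gP u uv)).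
  - by rewrite mulr_ge0// invr_ge0 ltW.
  - by rewrite ler_pM2l.
  - by rewrite ler_pM2l// invr_gt0.
rewrite /excursion_ratio (le_trans (ler_sum _ term))// sumr_const -mulr_natl.
rewrite -[leRHS]mulrA ler_wpM2r ?mulr_ge0 ?addr_ge0//.
by rewrite /n ler_nat max_card.
Qed.

End Isoperimetry.

(** * From the Euler scheme to the continuous-time chain *)

Local Open Scope classical_set_scope.
Local Open Scope ring_scope.

(** * The chain observed on a time grid *)

Section GridAvoidance.
Variables (R : realType) (S : finType) (d : measure_display)
  (Omega : measurableType d) (P : probability Omega R) (X : R -> Omega -> S)
  (p : R -> S -> S -> R) (Q : S -> S -> R) (u v : S).
Hypothesis XP : markov_process P p u X.

Local Notation pr A := (fine (P A)).

Lemma prE A : measurable A -> P A = (pr A)%:E.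
Proof. by move=> mA; rewrite fineK// fin_num_measure. Qed.

Lemma pr_ge0 A : 0 <= pr A.
Proof. exact: fine_ge0. Qed.

Lemma pr_le1 A : measurable A -> pr A <= 1.
Proof. by move=> mA; rewrite -lee_fin -prE// probability_le1. Qed.

Lemma pr_partition (D : pred S) (F : S -> set Omega) :
  (forall z, measurable (F z)) ->
  (forall y z w, F y w -> F z w -> y = z) ->
  pr (\bigcup_(z in [set` D]) F z) = \sum_(z | D z) pr (F z).
Proof.
move=> mF dF; apply: EFin_inj; rewrite -prE; last first.
  by apply: fin_bigcup_measurable.
rewrite measure_fin_bigcup//; last by move=> y z _ _ [w [Fy Fz]]; exact: dF Fy Fz.
rewrite (fsbigE (enum D)) ?enum_uniq//; last 2 first.
- by move=> z /=; rewrite mem_enum.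
- by move=> z /= Dz; rewrite mem_enum => /negP.
rewrite big_enum_cond/= -sumEFin; apply: eq_big => [z|z _]; last exact: prE.
by rewrite mem_setE andbb.
Qed.

(** Interpolates between the cylinder events of [markov_process], at [j = 0], and the avoidance of
    [v] before step [n], at [j = n]. *)
Definition path_event (ts : nat -> R) (xs : nat -> S) (n j : nat) : set Omega :=
  [set w | forall i, (i <= n)%N ->
    if (i < j)%N then X (ts i) w <> v else X (ts i) w = xs i].

Definition avoids (h : R) (n : nat) : set Omega :=
  [set w | forall i, (i <= n)%N -> X (i%:R * h) w <> v].

Let mX t x : 0 <= t -> measurable [set w | X t w = x].
Proof. by move=> t0; case: XP => mX _ _ _; exact: mX. Qed.

Let mXn t x : 0 <= t -> measurable [set w | X t w <> x].
Proof. by move=> t0; exact/measurableC/mX. Qed.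

Lemma measurable_path_event ts xs n j : (forall i, 0 <= ts i) ->
  measurable (path_event ts xs n j).
Proof.
move=> ts0; have -> : path_event ts xs n j = \bigcap_(i in [set i | (i <= n)%N])
    (if (i < j)%N then [set w | X (ts i) w <> v] else [set w | X (ts i) w = xs i]).
  by apply/seteqP; split => w H i /H; case: ifP.
by apply: bigcap_measurableType => i _; case: ifP => _; [exact: mXn|exact: mX].
Qed.

Lemma measurable_avoids h n : 0 <= h -> measurable (avoids h n).
Proof.
move=> h0; apply: bigcap_measurableType => i _.
by apply: mXn; rewrite mulr_ge0.
Qed.

Definition upd (xs : nat -> S) (j : nat) (z : S) : nat -> S :=
  fun i => if i == j then z else xs i.

Lemma path_event_split ts xs n j : (forall i, 0 <= ts i) -> (j <= n)%N ->
  pr (path_event ts xs n j.+1) =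
  \sum_(z | z != v) pr (path_event ts (upd xs j z) n j).
Proof.
move=> ts0 jn; rewrite -pr_partition; last 2 first.
- by move=> z; exact: measurable_path_event.
- by move=> y z w /(_ _ jn) + /(_ _ jn); rewrite ltnn /upd eqxx => -> ->.
congr (fine (P _)); apply/seteqP; split => w /=.
  move=> H; exists (X (ts j) w).
    by have /= := H _ jn; rewrite ltnSn => /eqP.
  move=> i /[dup] /H; rewrite /upd ltnS leq_eqVlt.
  by case: eqVneq => [->|_]/=; rewrite ?ltnn.
move=> [z /= /eqP zv] H i in_; have := H i in_; rewrite /upd [(i < j.+1)%N]ltnS.
rewrite [(i <= j)%N]leq_eqVlt; case: (eqVneq i j) => [->|_] //=.
by rewrite ltnn => ->.
Qed.

(** The Markov property passes from cylinder events to these by splitting over the state at one time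
    after another; [j <= n] leaves the last two states prescribed. *)
Lemma path_event_step ts xs n j :
  0 <= ts 0%N -> (forall i, ts i <= ts i.+1) -> (j <= n)%N ->
  pr (path_event ts xs n.+1 j) =
  pr (path_event ts xs n j) * p (ts n.+1 - ts n) (xs n) (xs n.+1).
Proof.
move=> ts0 tsS.
have ts_ge0 i : 0 <= ts i by elim: i => // i /le_trans; apply.
elim: j xs => [|j IH] xs jn.
  have E m : path_event ts xs m 0 =
      [set w | forall i, (i <= m)%N -> X (ts i) w = xs i].
    by apply/seteqP; split => w.
  case: XP => _ _ _ /(_ n ts xs ts0 tsS); rewrite -!E => ->.
  by rewrite fineM ?fin_num_measure//; exact: measurable_path_event.
rewrite !path_event_split ?(ltnW (leqW jn)) ?(ltnW jn)// mulr_suml.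
apply: eq_bigr => z _; rewrite IH ?(ltnW jn)// /upd.
by rewrite gtn_eqF// gtn_eqF// leqW.
Qed.

Definition avoid_at (h : R) (n : nat) (y : S) : R :=
  if y == v then 0 else pr (path_event (fun i => i%:R * h) (fun=> y) n n).

Lemma avoid_at0 h y : u != v -> avoid_at h 0 y = (y == u)%:R.
Proof.
move=> uv; rewrite /avoid_at; case: eqVneq => [->|yv].
  by rewrite eq_sym (negPf uv).
have -> : path_event (fun i => i%:R * h) (fun=> y) 0 0 = [set w | X 0 w = y].
  apply/seteqP; split => w /=; first by move=> /(_ 0%N isT); rewrite mul0r.
  by move=> H [|//] _; rewrite mul0r.
have [_ _ X0 _] := XP; have [->|yu] := eqVneq y u; first by rewrite X0.
apply/eqP; rewrite eq_le pr_ge0 andbT.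
suff : pr [set w | X 0 w = y] + pr [set w | X 0 w = u] <= 1.
  by rewrite X0 gerDr.
rewrite -lee_fin EFinD -!prE; try exact: mX.
rewrite -measureU; try exact: mX.
  by apply: probability_le1; apply: measurableU; exact: mX.
by apply/seteqP; split => w //= -[->] /eqP; rewrite (negPf yu).
Qed.

Lemma avoid_atS h n y : 0 <= h -> y != v ->
  avoid_at h n.+1 y = \sum_z avoid_at h n z * p h z y.
Proof.
move=> h0 yv; have ts_ge0 i : 0 <= i%:R * h by rewrite mulr_ge0.
rewrite [LHS]/avoid_at (negPf yv) path_event_split// [RHS](bigID (pred1 v))/=.
rewrite [X in _ = X + _]big1 ?add0r => [|z /eqP->]; last first.
  by rewrite /avoid_at eqxx mul0r.
apply: eq_bigr => z zv; rewrite /avoid_at (negPf zv) path_event_step ?mul0r//; last first.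
  by move=> i; rewrite ler_wpM2r// ler_nat.
rewrite /upd eqxx gtn_eqF// -mulrBl -natrB// subSnn mul1r; congr (fine (P _) * _).
by apply/seteqP; split => w H i in_; have := H i in_; case: ltnP => // ni;
  have -> : i = n by [apply/eqP; rewrite eqn_leq in_]; rewrite eqxx.
Qed.

Lemma avoids_sum h n : 0 <= h -> pr (avoids h n) = \sum_y avoid_at h n y.
Proof.
move=> h0; have ts_ge0 i : 0 <= i%:R * h by rewrite mulr_ge0.
rewrite [RHS](bigID (pred1 v))/= big1 ?add0r => [|y /eqP->]; last first.
  by rewrite /avoid_at eqxx.
rewrite (eq_bigr (fun y => pr (path_event (fun i => i%:R * h) (fun=> y) n n)));
  last by move=> y yv; rewrite /avoid_at (negPf yv).
rewrite -pr_partition; last 2 first.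
- by move=> z; exact: measurable_path_event.
- by move=> y z w /(_ _ (leqnn n)) + /(_ _ (leqnn n)); rewrite ltnn => -> ->.
congr (fine (P _)); apply/seteqP; split => w /=.
  move=> H; exists (X (n%:R * h) w); first exact/eqP/H.
  move=> i in_; case: ltnP => [_|ni]; first exact: H.
  by have -> : i = n by apply/eqP; rewrite eqn_leq in_.
by move=> [y /= /eqP yv] H i /H; case: ltnP => // _ ->.
Qed.

Hypotheses (uv : u != v) (Q_off_ge0 : forall x y, x != y -> 0 <= Q x y)
  (Q_row : forall x, \sum_y Q x y = 0).

(** The Euler step is a stochastic matrix, so it does not expand the l1 distance, and each
    replacement of it by [p h] adds at most [#|S| * e]. *)
Lemma avoids_killed (h e : R) (n : nat) : 0 <= h ->
  (forall x, 0 <= 1 + h * Q x x) ->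
  (forall x y, `|p h x y - ((x == y)%:R + h * Q x y)| <= e) ->
  `|pr (avoids h n) - \sum_y killed Q u v h n y| <= n%:R * (#|S|%:R * e).
Proof.
move=> h0 hq he; pose J x y : R := (x == y)%:R + h * Q x y.
have J_ge0 x y : 0 <= J x y.
  rewrite /J; have [<-|xy] := eqVneq x y; first exact: hq.
  by rewrite add0r mulr_ge0// Q_off_ge0.
have J_row x : \sum_y J x y = 1.
  rewrite big_split/= -mulr_sumr Q_row mulr0 addr0 (bigD1 x)//= eqxx.
  by rewrite big1 ?addr0// => y yx; rewrite eq_sym (negPf yx).
pose D m := \sum_y `|avoid_at h m y - killed Q u v h m y|.
have a_ge0 m y : 0 <= avoid_at h m y
  by rewrite /avoid_at; case: ifP => // _; exact: pr_ge0.
have a_le1 m : \sum_y avoid_at h m y <= 1.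
  by rewrite -avoids_sum// pr_le1//; exact: measurable_avoids.
have step m : D m.+1 <= D m + #|S|%:R * e.
  have le1 y : `|avoid_at h m.+1 y - killed Q u v h m.+1 y| <=
      \sum_z `|avoid_at h m z - killed Q u v h m z| * J z y +
      \sum_z avoid_at h m z * e.
    have [->|yv] := eqVneq y v.
      rewrite /avoid_at /= eqxx subrr normr0 addr_ge0//.
        by apply: sumr_ge0 => z _; rewrite mulr_ge0.
      apply: sumr_ge0 => z _; apply: mulr_ge0; first exact: a_ge0.
      by rewrite (le_trans _ (he z z)).
    rewrite avoid_atS//= (negPf yv) -sumrB -big_split/=.
    apply: le_trans (ler_norm_sum _ _ _) _; apply: ler_sum => z _.
    rewrite -/(J z y); set a := avoid_at h m z; set b := killed _ _ _ _ _ _.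
    have -> : a * p h z y - b * J z y = (a - b) * J z y + a * (p h z y - J z y).
      by ring.
    apply: le_trans (ler_normD _ _) _; apply: lerD.
      by rewrite normrM (ger0_norm (J_ge0 _ _)).
    by rewrite normrM (ger0_norm (a_ge0 _ _)) ler_wpM2l.
  apply: le_trans (ler_sum _ (fun y _ => le1 y)) _.
  rewrite big_split/= lerD//.
    by rewrite exchange_big/=; under eq_bigr do rewrite -mulr_sumr J_row mulr1.
  rewrite sumr_const -mulr_suml -[leLHS]mulr_natl ler_wpM2l//.
  by rewrite ler_piMl// (le_trans _ (he u u)).
have D_le m : D m <= m%:R * (#|S|%:R * e).
  elim: m => [|m IH]; last by rewrite -natr1; have := step m; lra.
  by rewrite /D big1 ?mul0r// => y _; rewrite avoid_at0//= subrr normr0.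
rewrite avoids_sum// -sumrB; apply: le_trans (D_le n).
exact: ler_norm_sum.
Qed.

End GridAvoidance.

(** * Elementary limits and exponential bounds *)

Section RealFacts.
Variable R : realType.

Lemma near_right_interval (t : R) (A : R -> Prop) :
  (\forall s \near t^'+, A s) ->
  exists2 e, 0 < e & forall s, t < s < t + e -> A s.
Proof.
rewrite near_withinE => /nbhs_ballP[e /= e0 He].
exists e => // s /andP[ts ste]; apply: He => //.
by rewrite /ball/= distrC ger0_norm ?subr_ge0 ?ltW// ltrBlDl.
Qed.

Lemma mesh_near0 (t e : R) : 0 < e -> \forall n \near \oo, t / 2 ^+ n < e.
Proof.
move=> e0; have d0 : 0 < e / (`|t| + 1) by rewrite divr_gt0.
near=> n; have : 1 / 2 ^+ n < e / (`|t| + 1).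
  by near: n; exact: (near_infty_natSinv_expn_lt (PosNum d0)).
rewrite ltr_pdivlMr// mul1r mulrC => /(le_lt_trans _); apply.
by rewrite ler_wpM2r ?invr_ge0 ?exprn_ge0// ler_wpDr// ler_norm.
Unshelve. all: end_near. Qed.

(** From [1 / (1 - x) = 1 + x / (1 - x) <= expR (x / (1 - x))]. *)
Lemma expr1B_ge (x : R) n : x < 1 -> expR (- (n%:R * (x / (1 - x)))) <= (1 - x) ^+ n.
Proof.
move=> x1; have x1' : 0 < 1 - x by rewrite subr_gt0.
rewrite -mulrN mulrC expRM_natr lerXn2r ?nnegrE ?expR_ge0 ?(ltW x1')//.
rewrite expRN invf_ple ?posrE ?expR_gt0//.
apply: le_trans (expR_ge1Dx _).
by rewrite le_eqVlt; apply/orP; left; apply/eqP; field; rewrite gt_eqF.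
Qed.

Lemma expr1B_le (x : R) n : x <= 1 -> (1 - x) ^+ n <= expR (- (n%:R * x)).
Proof.
move=> x1; rewrite -mulrN mulrC expRM_natr lerXn2r ?nnegrE ?expR_ge0 ?subr_ge0//.
exact: expR_ge1Dx.
Qed.

Lemma mulr_expRN_le1 (t : R) : t * expR (- t) <= 1.
Proof.
rewrite expRN ler_pdivrMr ?expR_gt0// mul1r (le_trans _ (expR_ge1Dx t))//.
by rewrite lerDr.
Qed.

End RealFacts.

(** * Survival probability and mean of the hitting time *)

Section HittingTime.
Variables (R : realType) (S : finType) (d : measure_display)
  (Omega : measurableType d) (P : probability Omega R) (X : R -> Omega -> S)
  (p : R -> S -> S -> R) (Q : S -> S -> R) (u v : S).
Hypotheses (pP : transition_function Q p) (XP : markov_process P p u X).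

Local Notation pr A := (fine (P A)).
Local Notation T := (hitting_time X v).
Local Notation mesh t n := (t / 2 ^+ n).
Local Notation avoids := (avoids X v).

Lemma hitting_ge0 w : (0 <= T w)%E.
Proof. by apply: le_ereal_inf_tmp => _ [t [t0 _] <-]; rewrite lee_fin. Qed.

Lemma hitting_le (t : R) w : 0 <= t -> X t w = v -> (T w <= t%:E)%E.
Proof. by move=> t0 Xt; apply: ereal_inf_lbound; exists t. Qed.

(** Right-continuity gives the strict inequality: a chain not at [v] at time [t] stays away for a
    while. *)
Lemma hitting_gtP (t : R) w : 0 <= t ->
  (t%:E < T w)%E <-> forall s, 0 <= s <= t -> X s w <> v.
Proof.
move=> t0; split.
  move=> tT s /andP[s0 st] Xs; have := hitting_le s0 Xs.
  by move/(lt_le_trans tT); rewrite lte_fin ltNge st.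
move=> H; case: XP => _ /(_ w t t0) /near_right_interval[e e0 He] _ _.
apply: (@lt_le_trans _ _ (t + e)%:E); first by rewrite lte_fin ltrDl.
apply: le_ereal_inf_tmp => _ [s [s0 Xs] <-]; rewrite lee_fin leNgt.
apply/negP => ste; have [st|ts] := leP s t.
  by apply: (H s) => //; rewrite s0.
by apply: (H t); rewrite ?lexx ?t0// -(He s) ?ts.
Qed.

Lemma hitting_gt_avoids (t n : R) m w : 0 <= t -> m%:R * n <= t ->
  0 <= n -> (t%:E < T w)%E -> avoids n m w.
Proof.
move=> t0 mt n0 /(hitting_gtP _ t0) H i im; apply: H.
by rewrite mulr_ge0//= (le_trans _ mt)// ler_wpM2r// ler_nat.
Qed.

Lemma mesh_mul (t : R) n : (2 ^ n)%:R * mesh t n = t.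
Proof. by rewrite natrX mulrC divfK. Qed.

(** By right-continuity a visit to [v] before [t] lasts long enough to be seen on a fine dyadic
    grid; [t] itself is a grid point. *)
Lemma hitting_gt_bigcap (t : R) : 0 <= t ->
  [set w | (t%:E < T w)%E] = \bigcap_n avoids (mesh t n) (2 ^ n)%N.
Proof.
move=> t0; have mesh_ge0 n : 0 <= mesh t n by rewrite divr_ge0.
apply/seteqP; split => w.
  by move=> /= tT n _; apply: (hitting_gt_avoids t0) => //; rewrite mesh_mul.
move=> H; apply/(hitting_gtP _ t0) => s /andP[s0 st] Xs.
move: st; rewrite le_eqVlt => /predU1P[se|st].
  by apply: (H 0%N I 1%N) => //; rewrite mul1r expr0 divr1 -se.
case: XP => _ /(_ w s s0) /near_right_interval[e e0 He] _ _.
have me : 0 < Num.min e (t - s) by rewrite lt_min e0 subr_gt0.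
have [N _ /(_ N (leqnn N))/=] := mesh_near0 t me; rewrite lt_min => /andP[ne nts].
have tp : 0 < t by exact: le_lt_trans st.
have np : 0 < mesh t N by rewrite divr_gt0 ?exprn_gt0.
have ex : exists i, s < i%:R * mesh t N.
  by exists (2 ^ N)%N; rewrite mesh_mul.
(* [i.+1] indexes the first grid time after [s], within one mesh of [s], hence before both [s + e]
   and [t]. *)
case: (ex_minnP ex) => -[|i] sm im; first by move: sm; rewrite mul0r ltNge s0.
have si : i%:R * mesh t N <= s.
  by rewrite leNgt; apply/negP => /im; rewrite ltnn.
have iE : i.+1%:R * mesh t N <= s + mesh t N by rewrite -natr1 mulrDl mul1r lerD2r.
apply: (H N I i.+1).
  rewrite -(ler_nat R) -(ler_pM2r np) mesh_mul.
  by apply: (le_trans iE); rewrite -lerBrDl ltW.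
rewrite He ?Xs// sm/=; apply: (le_lt_trans iE).
by rewrite ltrD2l.
Qed.

Lemma measurable_hitting_gt (t : R) : 0 <= t -> measurable [set w | (t%:E < T w)%E].
Proof.
move=> t0; rewrite hitting_gt_bigcap//; apply: bigcapT_measurable => n.
by apply: (measurable_avoids _ XP); rewrite divr_ge0.
Qed.

Lemma measurable_hitting_time : measurable_fun setT T.
Proof.
move=> mD; apply: (measurability _ (ErealGenOInfty.measurableE R)) => //.
move=> /= _ [_ [a ->]] <-; rewrite setTI preimage_itvoy.
have [a0|a0] := leP 0 a; first exact: measurable_hitting_gt.
have -> : [set w | (a%:E < T w)%E] = setT; last exact: measurableT.
apply/seteqP; split => // w _ /=.
by rewrite (lt_le_trans _ (hitting_ge0 w))// lte_fin.
Qed.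

(** Continuity from above: the dyadic grids are nested, index [i] at level [n] being [i.*2] at level
    [n.+1]. *)
Lemma avoids_cvg (t : R) : 0 <= t ->
  pr (avoids (mesh t n) (2 ^ n)%N) @[n --> \oo] --> pr [set w | (t%:E < T w)%E].
Proof.
move=> t0; have ma n : measurable (avoids (mesh t n) (2 ^ n)%N).
  by apply: (measurable_avoids _ XP); rewrite divr_ge0.
apply: fine_cvg; rewrite fineK ?fin_num_measure//; last exact: measurable_hitting_gt.
rewrite hitting_gt_bigcap//; apply: nonincreasing_cvg_mu => //.
- by rewrite -ge0_fin_numE// fin_num_measure.
- exact: bigcapT_measurable.
apply/nonincreasing_seqP => n; apply/subsetPset => w H i iN.
have := H i.*2; rewrite expnS mul2n leq_double => /(_ iN).
have -> // : i.*2%:R * mesh t n.+1 = i%:R * mesh t n.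
by rewrite -muln2 natrM exprS; field; rewrite expf_neq0.
Qed.

Hypotheses (uv : u != v) (Q_off_ge0 : forall x y, x != y -> 0 <= Q x y)
  (Q_row : forall x, \sum_y Q x y = 0).

Let small_step (e : R) : 0 < e -> exists2 h0, 0 < h0 & forall h, 0 <= h < h0 ->
  (forall x, 0 <= 1 + h * Q x x) /\
  (forall x y, `|p h x y - ((x == y)%:R + h * Q x y)| <= e * h).
Proof.
move=> e0; have [_ _ p0 _ dp] := pP.
have H1 : \forall h \near (0 : R)^'+, forall x y,
    `|p h x y - ((x == y)%:R + h * Q x y)| <= e * h.
  apply: filter_forall => x; apply: filter_forall => y.
  have /cvgrPdist_le/(_ e e0) := dp x y; apply: filterS2 (nbhs_right_gt 0) => h h0 dh.
  have -> : p h x y - ((x == y)%:R + h * Q x y) =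
      - h * (Q x y - (p h x y - (x == y)%:R) / h) by field; rewrite gt_eqF.
  by rewrite normrM normrN (gtr0_norm h0) mulrC ler_wpM2r// ltW.
have H2 : \forall h \near (0 : R)^'+, forall x, 0 <= 1 + h * Q x x.
  apply: filter_forall => x.
  have d0 : 0 < (`|Q x x| + 1)^-1 by rewrite invr_gt0 ltr_wpDl.
  apply: filterS2 (nbhs_right_gt 0) (nbhs_right_lt d0) => h h0.
  rewrite -div1r ltr_pdivlMr ?ltr_wpDl// => hq.
  have : - `|Q x x| <= Q x x by rewrite lerNl ler_normr lexx orbT.
  by nra.
have [h0 h00 Hh] := near_right_interval (filterI H1 H2).
exists h0 => // h /andP[]; rewrite le_eqVlt => /predU1P[<- _|hp hh0].
  split=> [x|x y]; first by rewrite mul0r addr0 ler01.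
  by rewrite p0 mul0r addr0 subrr normr0 mulr0.
by have [] := Hh h; rewrite ?hp ?add0r.
Qed.

Let mesh_approx (t e : R) : 0 <= t -> 0 < e -> \forall n \near \oo,
  (forall x, 0 <= 1 + mesh t n * Q x x) /\
  (forall m, (m <= 2 ^ n)%N ->
    `|pr (avoids (mesh t n) m) - \sum_y killed Q u v (mesh t n) m y| <= e).
Proof.
move=> t0 e0; have D0 : 0 < #|S|%:R * t + 1 by rewrite ltr_wpDl// mulr_ge0.
(* One-step errors proportional to the mesh add up over [2 ^ n] steps to at most [#|S| * t] times
   this constant; the [+ 1] covers [t = 0]. *)
have e'0 : 0 < e / (#|S|%:R * t + 1) by rewrite divr_gt0.
have [h0 h00 Hh] := small_step e'0.
near=> n; have n0 : 0 <= mesh t n by rewrite divr_ge0.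
have [|Ha Hb] := Hh (mesh t n).
  by rewrite n0/=; near: n; exact: mesh_near0.
split=> // m mn.
apply: le_trans (avoids_killed XP uv Q_off_ge0 Q_row m n0 Ha Hb) _.
rewrite (@le_trans _ _ ((2 ^ n)%:R *
    (#|S|%:R * (e / (#|S|%:R * t + 1) * mesh t n))))//.
  rewrite ler_wpM2r ?ler_nat//; apply: mulr_ge0 => //.
  by apply: mulr_ge0 => //; exact: ltW.
have -> : (2 ^ n)%:R * (#|S|%:R * (e / (#|S|%:R * t + 1) * mesh t n)) =
    e * (#|S|%:R * ((2 ^ n)%:R * mesh t n) / (#|S|%:R * t + 1)) by ring.
by rewrite mesh_mul ger_pMr// ler_pdivrMr// mul1r lerDl.
Unshelve. all: end_near. Qed.

Variables (kappa eps : R).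
Hypotheses (kappa_gt0 : 0 < kappa) (eps_ge0 : 0 <= eps).
Hypothesis massP : forall h n, 0 <= h -> (forall x, 0 <= 1 + h * Q x x) ->
  (1 - h * kappa) ^+ n <= \sum_y killed Q u v h n y
    <= (1 - h * kappa) ^+ n + 2 * eps.
Hypothesis occupationP : forall h n, 0 <= h -> (forall x, 0 <= 1 + h * Q x x) ->
  h * \sum_(i < n) \sum_y killed Q u v h i y <= (1 + eps) / kappa.

Lemma survival_bounds (t : R) : 0 <= t ->
  expR (- (kappa * t)) <= pr [set w | (t%:E < T w)%E]
    <= expR (- (kappa * t)) + 2 * eps.
Proof.
move=> t0; have ne n : (2 ^ n)%:R * (mesh t n * kappa) = kappa * t.
  by rewrite mulrA mesh_mul mulrC.
have n0 n : 0 <= mesh t n by rewrite divr_ge0.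
have small : \forall n \near \oo, mesh t n * kappa < 1.
  have ki : 0 < kappa^-1 by rewrite invr_gt0.
  by apply: filterS (mesh_near0 t ki) => n; rewrite -[kappa^-1]div1r ltr_pdivlMr.
apply/andP; split; apply/ler_addgt0Pr => e e0; last first.
  apply: (cvgr_to_le (avoids_cvg t0)); near=> n.
  have [Ha /(_ _ (leqnn _)) +] : (forall x, 0 <= 1 + mesh t n * Q x x) /\
      (forall m, (m <= 2 ^ n)%N ->
      `|pr (avoids (mesh t n) m) - \sum_y killed Q u v (mesh t n) m y| <= e).
    by near: n; exact: mesh_approx.
  have /andP[_] := massP (2 ^ n) (n0 n) Ha.
  have : mesh t n * kappa <= 1 by apply/ltW; near: n.
  move=> /(expr1B_le (2 ^ n)); rewrite ne ler_norml => + + /andP[_].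
  lra.
rewrite -lerBlDr; apply: (cvgr_to_ge (avoids_cvg t0)).
have e2 : 0 < e / 2 by rewrite divr_gt0.
(* [expr1B_ge] bounds the geometric factor below by this exponential at [y = x / (1 - x)], where [x]
   is the mesh times [kappa]; [y < r] amounts to [x < r / (1 + r)]. *)
have /cvgrPdist_le/(_ _ e2) : expR (- (kappa * t + kappa * t * y)) @[y --> (0 : R)]
    --> expR (- (kappa * t + kappa * t * 0)).
  apply: continuous_cvg; first exact: continuous_expR.
  apply: cvgN; apply: cvgD; first exact: cvg_cst.
  by apply: cvgMr; exact: cvg_id.
move=> /nbhs_ballP[r /= r0 Hr].
have kr : 0 < r / (kappa * (1 + r)).
  by rewrite divr_gt0// mulr_gt0// addr_gt0.
near=> n; have [Ha /(_ _ (leqnn _)) +] : (forall x, 0 <= 1 + mesh t n * Q x x) /\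
    (forall m, (m <= 2 ^ n)%N ->
    `|pr (avoids (mesh t n) m) - \sum_y killed Q u v (mesh t n) m y| <= e / 2).
  by near: n; exact: mesh_approx.
have /andP[+ _] := massP (2 ^ n) (n0 n) Ha.
have x1 : mesh t n * kappa < 1 by near: n.
have nr : mesh t n < r / (kappa * (1 + r)) by near: n; exact: mesh_near0.
set x := mesh t n * kappa in x1 *.
have x0 : 0 <= x by rewrite mulr_ge0// ltW.
have xr : x / (1 - x) < r.
  rewrite ltr_pdivrMr ?subr_gt0//.
  move: nr; rewrite ltr_pdivlMr ?mulr_gt0 ?addr_gt0// mulrA -/x; lra.
have := expr1B_ge (2 ^ n) x1.
have -> : (2 ^ n)%:R * (x / (1 - x)) = kappa * t + kappa * t * (x / (1 - x)).
  by rewrite -(ne n) -/x; field; rewrite subr_eq0 gt_eqF.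
have := Hr (x / (1 - x)); rewrite /ball/= sub0r normrN ger0_norm; last first.
  by rewrite divr_ge0// subr_ge0 ltW.
move=> /(_ xr); rewrite mulr0 addr0 !ler_norml => /andP[_ h1] h2 h3 /andP[h4 _].
by lra.
Unshelve. all: end_near. Qed.

Lemma integral_indic_sum h m (A : nat -> set Omega) : 0 <= h ->
  (forall k, measurable (A k)) ->
  (\int[P]_w (\sum_(k < m) h * \1_(A k) w)%:E = (\sum_(k < m) h * pr (A k))%:E)%E.
Proof.
move=> h0 mA; under eq_integral do rewrite -sumEFin.
rewrite ge0_integral_sum//; last 2 first.
- by move=> k; apply/measurable_EFinP; apply: measurable_funM.
- by move=> k w _; rewrite lee_fin mulr_ge0// indicE.
rewrite -sumEFin; apply: eq_bigr => k _; under eq_integral do rewrite EFinM.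
rewrite ge0_integralZl_EFin//; last first.
  by apply/measurable_EFinP; exact: measurable_indic.
by rewrite integral_indic// setIT EFinM fineK// fin_num_measure.
Qed.

(** An upper Riemann sum for the truncated hitting time; the real [a] stands for the truncation
    because [T w] may be infinite. *)
Lemma le_sum_avoids (h a : R) m w : 0 <= h -> (a%:E <= T w)%E -> a <= m%:R * h ->
  a <= \sum_(k < m) h * \1_(avoids h k) w.
Proof.
move=> h0; elim: m a => [|m IH] a aT; first by rewrite big_ord0 mul0r.
rewrite -natr1 mulrDl mul1r big_ord_recr/= indicE => am.
have [wA|wA] := boolP (w \in avoids h m).
  rewrite mulr1 -lerBlDr IH ?lerBlDr// (le_trans _ aT)// lee_fin.
  by rewrite lerBlDr lerDl.
rewrite mulr0 addr0 IH//.
move: wA; rewrite notin_setE => /existsNP[i /not_implyP[im /contrapT Xi]].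
have := le_trans aT (hitting_le (mulr_ge0 (ler0n _ i) h0) Xi).
by rewrite lee_fin => /le_trans; apply; rewrite ler_wpM2r// ler_nat.
Qed.

(** A lower Riemann sum; the bound by [m%:R * h] feeds the induction for the other half. *)
Lemma sum_hitting_gt_le (h : R) m w : 0 <= h ->
  \sum_(k < m) h * \1_[set w | ((k.+1%:R * h)%:E < T w)%E] w <= m%:R * h /\
  ((\sum_(k < m) h * \1_[set w | ((k.+1%:R * h)%:E < T w)%E] w)%:E <= T w)%E.
Proof.
move=> h0; elim: m => [|m [IH1 IH2]].
  by rewrite big_ord0 mul0r hitting_ge0.
rewrite big_ord_recr/= -[m.+1%:R in X in _ <= X]natr1 mulrDl mul1r indicE.
have [wA|wA] := boolP (w \in _).
  rewrite mulr1 lerD2r; split=> //; move: wA; rewrite inE/= => /ltW.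
  by apply: le_trans; rewrite lee_fin -natr1 mulrDl mul1r lerD2r.
by rewrite mulr0 addr0; split=> //; rewrite (le_trans IH1)// lerDl.
Qed.

(** After truncation at [t] a finite grid suffices, and the upper Riemann sum is compared with
    [occupationP]. *)
Lemma trunc_mean_le (t : R) : 0 <= t ->
  (\int[P]_w mine (T w) t%:E <= ((1 + eps) / kappa)%:E)%E.
Proof.
move=> t0; apply/lee_addgt0Pr => e e0; rewrite -EFinD.
have e'0 : 0 < e / (t + 1) by rewrite divr_gt0// ltr_wpDl.
have [n _ /(_ n (leqnn n))[Ha Hb]] := mesh_approx t0 e'0.
have n0 : 0 <= mesh t n by rewrite divr_ge0.
have mA k : measurable (avoids (mesh t n) k) by exact: (measurable_avoids _ XP).
apply: (@le_trans _ _
    (\int[P]_w (\sum_(k < 2 ^ n) mesh t n * \1_(avoids (mesh t n) k) w)%:E)%E).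
  apply: ge0_le_integral => //.
  - by move=> w _; rewrite le_min hitting_ge0 lee_fin.
  - exact: (measurable_mine measurable_hitting_time).
  - apply/measurable_EFinP; apply: measurable_sum => k.
    exact: measurable_funM.
  move=> w _; have : (0 <= mine (T w) t%:E)%E by rewrite le_min hitting_ge0 lee_fin.
  have : (mine (T w) t%:E <= t%:E)%E by rewrite ge_min lexx orbT.
  have : (mine (T w) t%:E <= T w)%E by rewrite ge_min lexx.
  case: (mine _ _) => [a| |]// aT; rewrite !lee_fin => at_ _.
  by apply: le_sum_avoids => //; rewrite mesh_mul.
rewrite integral_indic_sum// lee_fin -mulr_sumr.
apply: (@le_trans _ _ (mesh t n * \sum_(k < 2 ^ n)
    (\sum_y killed Q u v (mesh t n) k y + e / (t + 1)))).
  rewrite ler_wpM2l//; apply: ler_sum => k _; rewrite -lerBlDl.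
  by apply: le_trans (ler_norm _) (Hb k _); exact/ltnW/ltn_ord.
rewrite big_split/= mulrDr lerD ?occupationP// sumr_const card_ord.
rewrite -[X in _ * X <= _]mulr_natl.
rewrite mulrCA mulrA mesh_mul mulrA ler_pdivrMr ?ltr_wpDl//.
by rewrite mulrC ler_pM2l// lerDl.
Qed.

Lemma mean_le : (mean_hitting_time P X v <= ((1 + eps) / kappa)%:E)%E.
Proof.
pose g n w := mine (T w) n%:R%:E.
have gT w : g n w @[n --> \oo] --> T w.
  rewrite /g; have := hitting_ge0 w; case: (T w) => [r| |]//= r0.
    apply: cvg_near_cst; exists (Num.bound r) => // n /= rn.
    apply/min_idPl; rewrite lee_fin (le_trans (ltW (archi_boundP _)))//.
    by rewrite ler_nat.
  apply: (@cvg_trans _ ((n%:R : R)%:E @[n --> \oo])); last first.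
    by apply/cvgenyP; exact: cvg_id.
  by apply: near_eq_cvg; apply: nearW => n; rewrite /= min_r ?leey.
have -> : mean_hitting_time P X v = (\int[P]_w limn (g^~ w))%E.
  by apply: eq_integral => w _; rewrite (cvg_lim _ (gT w)).
have gmono w : {homo g^~ w : n m / (n <= m)%N >-> (n <= m)%E}.
  by move=> n m nm; rewrite /g le_min ge_min lexx /= ge_min lee_fin ler_nat nm orbT.
rewrite monotone_convergence//.
- apply: lime_le.
    apply: ereal_nondecreasing_is_cvgn => n m nm; apply: ge0_le_integral => //.
    + by move=> w _; rewrite le_min hitting_ge0 lee_fin ler0n.
    + exact: (measurable_mine measurable_hitting_time).
    + exact: (measurable_mine measurable_hitting_time).
    + by move=> w _; exact: gmono.
  by apply: nearW => n; exact: trunc_mean_le.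
- by move=> n; exact: (measurable_mine measurable_hitting_time).
- by move=> n w _; rewrite le_min hitting_ge0 lee_fin ler0n.
Qed.

Lemma mean_ge : ((kappa^-1)%:E <= mean_hitting_time P X v)%E.
Proof.
apply/lee_addgt0Pr => e e0.
have ke0 : 0 < kappa * e by rewrite mulr_gt0.
(* After multiplication by [kappa] the Riemann sum loses [kappa * h] at each end, together
   [kappa * e]; [m] is chosen so large that [expR (- (kappa * (m.+1%:R * h))) <= kappa * h]. *)
pose h := e / 2; have h0 : 0 < h by rewrite divr_gt0.
pose m := Num.bound (1 / (kappa * h) ^+ 2).
have kh0 : 0 < kappa * h by rewrite mulr_gt0.
pose A k := [set w | ((k.+1%:R * h)%:E < T w)%E].
have mA k : measurable (A k).
  by apply: measurable_hitting_gt; rewrite mulr_ge0// ltW.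
have : (\int[P]_w (\sum_(k < m) h * \1_(A k) w)%:E
    <= mean_hitting_time P X v)%E.
  apply: ge0_le_integral => //.
  - by move=> w _; rewrite lee_fin sumr_ge0// => k _; rewrite mulr_ge0 ?indicE// ltW.
  - apply/measurable_EFinP; apply: measurable_sum => k.
    exact: measurable_funM.
  - exact: measurable_hitting_time.
  - by move=> w _; apply: (sum_hitting_gt_le m w (ltW h0)).2.
rewrite integral_indic_sum//; last exact: ltW.
set s := \sum_(k < m) _ => sM; apply: (@le_trans _ _ (s%:E + e%:E)%E); last first.
  by rewrite leeD2r.
rewrite -EFinD lee_fin.
pose f k := expR (- (kappa * (k.+1%:R * h))).
(* [1 - exp (- x) <= x] makes the Riemann sum of the tail telescope. *)
have tel n : f 0%N - f n <= kappa * \sum_(k < n) h * pr (A k).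
  elim: n => [|n IH]; first by rewrite subrr big_ord0 mulr0.
  rewrite big_ord_recr/= mulrDr.
  have /andP[fk _] : f n <= pr (A n)
      <= f n + 2 * eps.
    by apply: survival_bounds; rewrite mulr_ge0// ltW.
  have fS : f n * (1 - kappa * h) <= f n.+1.
    have -> : f n.+1 = f n * expR (- (kappa * h)).
      by rewrite /f -expRD -[n.+2%:R]natr1; congr expR; ring.
    by rewrite ler_wpM2l ?expR_ge0// (le_trans _ (expR_ge1Dx _)).
  have : kappa * (h * f n) <= kappa * (h * pr (A n)).
    by rewrite !ler_pM2l.
  by lra.
have f0 : 1 - kappa * h <= f 0%N.
  by rewrite /f mul1r (le_trans _ (expR_ge1Dx _)).
have fm : f m <= kappa * h.
  rewrite /f expRN invf_ple ?posrE ?expR_gt0//.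
  apply: le_trans (expR_ge1Dx _).
  have : 1 / (kappa * h) ^+ 2 < m%:R.
    by apply: archi_boundP; rewrite divr_ge0// exprn_ge0// ltW.
  rewrite ltr_pdivrMr ?exprn_gt0// -[_^-1]div1r ler_pdivrMr// -natr1 => m1.
  have : 0 <= kappa * h * (kappa * h) by rewrite mulr_ge0// ltW.
  move: m1; rewrite expr2; lra.
rewrite -(ler_pM2l kappa_gt0) divff ?gt_eqF// mulrDr.
have := tel m; rewrite -/s /h in f0 fm *; lra.
Qed.

(** [survival_bounds] at time [t * M], where [1 <= kappa * M <= 1 + eps] for the mean [M]. *)
Lemma exponential_law (t : R) : 0 <= t ->
  `|normalised_survival P X v t - expR (- t)| <= 2 * eps.
Proof.
move=> t0; have Mle := mean_le; have Mge := mean_ge.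
rewrite /normalised_survival; move: Mle Mge.
have ki0 : 0 < kappa^-1 by rewrite invr_gt0.
case: (mean_hitting_time P X v) => [M| |]//; rewrite !lee_fin => Mle Mge.
have M0 : 0 < M by exact: lt_le_trans Mge.
have -> : [set w | (t%:E < T w / M%:E)%E] = [set w | ((t * M)%:E < T w)%E].
  apply/seteqP; split => w /=; by rewrite inver gt_eqF// lte_pdivlMr// EFinM.
have tM0 : 0 <= t * M by rewrite mulr_ge0// ltW.
have /andP[F1 F2] := survival_bounds tM0.
have kM1 : 1 <= kappa * M by rewrite -(mulfV (lt0r_neq0 kappa_gt0)) ler_pM2l.
have kM2 : kappa * M <= 1 + eps by rewrite mulrC -ler_pdivlMr.
have E1 : expR (- (kappa * (t * M))) <= expR (- t).
  by rewrite ler_expR lerN2; nra.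
(* A shift of [eps * t] in the exponent costs at most [eps], uniformly in [t], because
   [t * expR (- t) <= 1]. *)
have E2 : expR (- t) - eps <= expR (- (kappa * (t * M))).
  have le2 : - t + - (eps * t) <= - (kappa * (t * M)) by nra.
  apply: le_trans (_ : expR (- t + - (eps * t)) <= _); last by rewrite ler_expR.
  rewrite expRD.
  have := expR_ge1Dx (- (eps * t)); have := mulr_expRN_le1 t.
  have := expR_gt0 (- t); set x := expR (- t); set y := expR _ => x0 tx y1.
  have : x * (1 + - (eps * t)) <= x * y by rewrite ler_pM2l.
  have : eps * (t * x) <= eps by rewrite ler_piMr.
  by lra.
by rewrite ler_norml; apply/andP; split; lra.
Qed.

End HittingTime.

(** * Choice of the constants and conclusion *)

Section Assembly.
Variable R : realType.

Lemma uniform_gap (n : nat) (f : nat -> R) :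
  (forall i, (1 <= i < n)%N -> 0 < f i) ->
  exists2 e, 0 < e <= 1 & forall i, (1 <= i < n)%N -> e <= f i.
Proof.
move=> f0; exists (\big[Num.min/1]_(i < n | (1 <= i)%N) f i).
  rewrite bigmin_le_id andbT; apply/bigmin_gtP; split=> // i i1.
  by rewrite f0// i1 ltn_ord.
move=> i /andP[i1 ni]; exact: (bigmin_le_cond 1 (j := Ordinal ni)).
Qed.

Lemma maximum_attained (n : nat) (f : nat -> R) : (1 <= n)%N ->
  exists2 m, (1 <= m <= n)%N & forall j, (1 <= j <= n)%N -> f j <= f m.
Proof.
move=> n1; have n0 : (0 < n)%N by [].
case: (@arg_maxP _ _ _ (Ordinal n0) predT (fun i : 'I_n => f i.+1) isT) => i _ Hi.
exists i.+1; first by rewrite /= ltn_ord.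
by move=> [//|j] /andP[_ jn]; exact: (Hi (Ordinal jn)).
Qed.

Lemma powR_neg_cvg0 (C a e : R) : 0 < a -> 0 < e ->
  \forall x \near +oo, C * x `^ (- a) < e.
Proof.
move=> a0 e0; near=> x.
have x0 : 0 < x by near: x; exact: nbhs_pinfty_gt.
pose y := (`|C| + 1) / e; have y0 : 0 < y by rewrite divr_gt0// ltr_wpDl.
have yx : y < x `^ a.
  have -> : y = (y `^ a^-1) `^ a by rewrite -powRrM mulVf ?gt_eqF// powRr1// ltW.
  have yx : y `^ a^-1 < x by near: x; exact: nbhs_pinfty_gt.
  by apply: gt0_ltr_powR; rewrite ?nnegrE ?powR_ge0 ?(ltW x0).
rewrite powRN ltr_pdivrMr ?powR_gt0//; apply: le_lt_trans (ler_norm C) _.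
apply: (@lt_trans _ _ (`|C| + 1)); first by rewrite ltrDl.
by move: yx; rewrite ltr_pdivrMr// mulrC.
Unshelve. all: end_near. Qed.

End Assembly.

Theorem theorem1p2 (R : realType) (U V : finType) (E : U -> V -> bool)
    (alpha : R) (phi : R -> R) (sstar stilde : nat)
    (d : measure_display) (Omega : R -> measurableType d)
    (P : forall lambda, probability (Omega lambda) R)
    (X : forall lambda, R -> Omega lambda -> config E)
    (hU : (0 < #|U|)%N) (hV : (0 < #|V|)%N)
    (hconn : connected_graph E)
    (halpha : 0 < alpha < 1)
    (hphi : activity_exponent alpha phi)
    (hX : \forall lambda \near +oo,
      markov_chain (P lambda) (hardcore_generator lambda (phi lambda))
        (config_u E) (X lambda))
    (hsstar : critical_size E alpha sstar)
    (hstilde : resettling_size E alpha sstar stilde)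
    (hUV : #|U|%:R < (1 + alpha) * #|V|%:R)
    (hnum : forall a : V, exists s : seq V,
      [/\ isoperimetric_numbering E s, (stilde <= size s)%N
        & ohead s = Some a]) :
  {uniform `[0, +oo[,
    (fun lambda : R => normalised_survival (P lambda) (X lambda) (config_v E))
      @ +oo --> (fun t : R => expR (- t))}.
Proof.
(* [s0] will be the first such size; [stilde] is one, so [s0 <= stilde] and the numberings are long
   enough. *)
have ex0 : exists s, [&& (1 <= s)%N, (s <= #|V|)%N
    & (min_deficit E s)%:~R <= alpha * s%:R].
  case: hstilde => -[/andP[s1 s2] s3] _; exists stilde; apply/and3P; split=> //.
  exact: leq_ltn_trans s1.
case: (ex_minnP ex0) => s0 /and3P[s01 s0V s0P] s0min.
have s0_range : (1 <= s0 <= #|V|)%N by rewrite s01.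
have s0_stilde : (s0 <= stilde)%N.
  case: hstilde => -[/andP[s1 s2] s3] _; apply: s0min; apply/and3P; split=> //.
  exact: leq_ltn_trans s1.
have num a : exists s : seq V,
    [/\ isoperimetric_numbering E s, (s0 <= size s)%N & ohead s = Some a].
  have [s [h1 h2 h3]] := hnum a; exists s; split=> //; exact: leq_trans h2.
have [delta delta_range gap'] : exists2 e : R, 0 < e <= 1 &
    forall i, (1 <= i < s0)%N -> e <= (min_deficit E i)%:~R - alpha * i%:R.
  apply: uniform_gap => i /andP[i1 is0]; rewrite subr_gt0 ltNge.
  apply/negP => h; have := s0min i; rewrite i1 h (ltnW (leq_trans is0 s0V)).
  by move=> /(_ isT); rewrite leqNgt is0.
have gap i : (1 <= i < s0)%N -> alpha * i%:R + delta <= (min_deficit E i)%:~R.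
  by move=> /gap'; lra.
have [s1 s1_range s1max] := maximum_attained (gain E alpha) s01.
have /andP[delta_gt0 delta_le1] := delta_range.
have /andP[alpha_gt0 alpha_lt1] := halpha.
(* This makes the exponent [2 * theta - delta] of [excursion_small] equal to [- (delta / 2)]. *)
pose theta := delta / 4; have theta_gt0 : 0 < theta by rewrite divr_gt0.
case: hphi => eps eps0 phiE.
pose C : R := #|{: config E}|%:R *
  (#|{: config E}|%:R ^+ 4 * #|{: U + V}|%:R + 1).
(* The first bound lets [theta] cover the error over all sites of [V]; the second keeps the exponent
   [1 + alpha + eta] at least 1. *)
have small : \forall lambda \near +oo, `|eps lambda| <= Num.min (theta / #|V|%:R) alpha.
  have m0 : 0 < Num.min (theta / #|V|%:R) alpha.
    by rewrite lt_min alpha_gt0 divr_gt0// ltr0n.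
  have /cvgr0Pnorm_le := eps0; exact.
move=> A /uniform_nbhs[B []]; rewrite -entourage_ballE => -[e /= e0 eB] BA.
(* The deviation is at most twice the excursion ratio, hence below [e / 2]. *)
have e4 : 0 < e / 4 by rewrite divr_gt0.
have d2 : 0 < delta / 2 by rewrite divr_gt0.
have Csmall := powR_neg_cvg0 C d2 e4.
rewrite /nbhs /=.
near=> lambda; apply: BA => t /=; rewrite in_itv/= andbT => t0; apply: eB.
have lam_ge1 : 1 <= lambda by near: lambda; exact: nbhs_pinfty_ge.
have [p pP XP] : markov_chain (P lambda) (hardcore_generator lambda (phi lambda))
    (config_u E) (X lambda) by near: lambda.
have phil : phi lambda = lambda `^ (1 + alpha + eps lambda) by near: lambda.
have epsl : `|eps lambda| <= Num.min (theta / #|V|%:R) alpha by near: lambda.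
have Cl : C * lambda `^ (- (delta / 2)) < e / 4 by near: lambda.
rewrite phil in pP; set eta := eps lambda in pP epsl.
move: epsl; rewrite le_min ler_pdivlMr ?ltr0n// => /andP[etaP].
rewrite ler_norml => /andP[eta_ge _].
have beta_ge1 : 1 <= 1 + alpha + eta by lra.
have theta_le : theta <= delta by rewrite /theta; lra.
pose cond := conductance lambda (1 + alpha + eta) (E := E).
have csym : forall x y, cond x y = cond y x := conductance_sym (E := E) _ lam_ge1.
have cge0 : forall x y, 0 <= cond x y := conductance_ge0 (E := E) _ lam_ge1.
have resP := resistanceP s0_range s0P delta_range gap s1max num lam_ge1
  beta_ge1 etaP theta_le hU hV hconn.
have uv := config_uv E hU.
have [g gP] : exists g : config E -> config E -> R,
    forall y, y != config_v E -> is_green cond (config_v E) y (g y).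
  have : forall y, exists gy, y != config_v E -> is_green cond (config_v E) y gy.
    move=> y; have [->|yv] := eqVneq y (config_v E); first by exists (fun=> 0).
    by have [gy gyP] := green_exists resP yv; exists gy.
  by move=> /choice[g gP]; exists g.
have mu0 x := weight_gt0 (E := E) (1 + alpha + eta) lam_ge1 x.
have Qoff := generator_off (E := E) lambda (1 + alpha + eta).
have Qrow := generator_row (E := E) lambda (1 + alpha + eta).
have theta2 : 2 * theta <= delta by rewrite /theta; lra.
have := excursion_small s0_range s0P delta_range gap s1max num lam_ge1
  beta_ge1 etaP theta_le hU hV hconn s1_range erefl theta2 gP.
set rho := excursion_ratio _ _ _ => rho_le.
have rho_small : rho < e / 4.
  apply: le_lt_trans rho_le _; apply: le_lt_trans Cl.
  by rewrite /C /theta; have -> : 2 * (delta / 4) - delta = - (delta / 2) by field.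
have Q0 (x y : config E) : x != y ->
    0 <= hardcore_generator lambda (lambda `^ (1 + alpha + eta)) x y.
  by move=> xy; rewrite -(pmulr_rge0 _ (mu0 x)) Qoff.
have law := exponential_law pP XP uv Q0 Qrow
  (escape_rate_gt0 csym cge0 resP mu0 uv gP)
  (excursion_ratio_ge0 csym cge0 resP mu0 uv gP)
  (fun h n h0 hs => killed_mass csym cge0 resP mu0 Qoff Qrow uv gP h0 hs n)
  (fun h n h0 hs => killed_occupation csym cge0 resP mu0 Qoff Qrow uv gP h0 hs n)
  t0.
rewrite /ball /= distrC; apply: le_lt_trans law _; rewrite -/rho; lra.
Unshelve. all: end_near. Qed.
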